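(* For every real $d$ with $0\le d\le \tfrac12$, the fourth cumulant $\kappa_4(d)$ of the Rosenblatt distribution with parameter $d$ is $$\kappa_4(d)=\frac{12(1-2d)^2}{(1-d)(3-4d)}\left(\frac{2\,\Gamma(1-d)\,\Gamma(2-d)^2}{\Gamma(3-3d)}+\frac{\Gamma(1-d)^2\,\Gamma(2-d)^2}{\Gamma(2-2d)^2}+{}_3F_2\!\left(1,\,d,\,2-2d;\;2-d,\,3-2d;\;1\right)\right).$$
   Context: For $0\le d\le\tfrac12$ and an integer $k\ge 2$ put $$c_k=c_k(d)=\int_0^1\!\int_0^1\!\cdots\!\int_0^1 |x_1-x_2|^{-d}|x_2-x_3|^{-d}\cdots|x_{k-1}-x_k|^{-d}|x_k-x_1|^{-d}\,dx_1\,dx_2\cdots dx_k ,$$ and $\sigma(d)=\left(\tfrac12(1-2d)(1-d)\right)^{1/2}$. The Rosenblatt distribution with parameter $d$ has characteristic function given, for $\theta$ near the origin, by $$\varphi(\theta)=\exp\left(\frac12\sum_{k=2}^\infty\big(2i\theta\,\sigma(d)\big)^k\frac{c_k}{k}\right),$$ and its $k$-th cumulant, for $k\ge2$, is given by $$\kappa_k(d)=2^{k-1}(k-1)!\,\big(\sigma(d)\big)^k c_k .$$ In particular $\kappa_4(d)=48\left(\tfrac12(1-2d)(1-d)\right)^2c_4(d)$, where $$c_4(d)=\int_{[0,1]^4}|x_1-x_2|^{-d}|x_2-x_3|^{-d}|x_3-x_4|^{-d}|x_4-x_1|^{-d}\,dx_1dx_2dx_3dx_4 .$$ Here $\Gamma$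 is the Gamma function, $(a)_n=a(a+1)\cdots(a+n-1)$ with $(a)_0=1$ is the Pochhammer symbol, and ${}_3F_2(a,b,c;e,f;z)=\sum_{n=0}^\infty \frac{(a)_n(b)_n(c)_n}{(e)_n(f)_n}\frac{z^n}{n!}$ is the generalized hypergeometric function. *)

(* Defs.v *)
From HB Require Import structures.
From mathcomp Require Import all_boot all_order all_algebra.
From mathcomp Require Import all_classical all_reals all_analysis.
Set Implicit Arguments.
Unset Strict Implicit.
Unset Printing Implicit Defensive.
Import Order.TTheory GRing.Theory Num.Theory.
Import numFieldNormedType.Exports.

Local Open Scope classical_set_scope.
Local Open Scope ring_scope.

(* Iterated Lebesgue integral of F over the cube [0,1]^k; a point of the cube
   is presented to F as the sequence [:: x_1; ...; x_k] of its coordinates. *)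
Fixpoint cube_integral (R : realType) (k : nat) (F : seq R -> \bar R) : \bar R :=
  if k is k'.+1 then
    (\int[@lebesgue_measure R]_(x in `[0%R, 1%R])
       cube_integral k' (fun s => F (x :: s)))%E
  else F [::].

(* |x_1 - x_2|^(-d) |x_2 - x_3|^(-d) ... |x_k - x_1|^(-d).  The value given by
   powR where a difference vanishes (0 `^ (- d) = (d == 0)%:R) only concerns a
   null set. *)
Definition cyclic_kernel (R : realType) (d : R) (k : nat) (s : seq R) : R :=
  \prod_(i < k) `|s`_i - s`_(i.+1 %% k)| `^ (- d).

(* Extended-real valued: c_2(1/2) = +oo. *)
Definition rosenblatt_c (R : realType) (d : R) (k : nat) : \bar R :=
  cube_integral k (fun s => (cyclic_kernel d k s)%:E).

Definition rosenblatt_sigma (R : realType) (d : R) : R :=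
  Num.sqrt (2^-1 * (1 - 2 * d) * (1 - d)).

(* The k-th cumulant (k >= 2) of the Rosenblatt distribution with parameter d,
   i.e. the coefficient of (i theta)^k / k! in the logarithm
     1/2 \sum_(k >= 2) (2 i theta sigma(d))^k c_k(d) / k
   of its characteristic function near the origin. *)
Definition rosenblatt_cumulant (R : realType) (d : R) (k : nat) : \bar R :=
  ((2 ^+ k.-1 * (k.-1)`!%:R * rosenblatt_sigma d ^+ k)%:E
     * rosenblatt_c d k)%E.

(* Euler's integral, meaningful for z > 0. *)
Definition Gamma (R : realType) (z : R) : R :=
  \int[@lebesgue_measure R]_(t in `]0, +oo[) (t `^ (z - 1) * expR (- t)).

Definition pochhammer (R : realType) (a : R) (n : nat) : R :=
  \prod_(i < n) (a + i%:R).

Definition hypergeometric_3F2 (R : realType) (a b c e f z : R) : R :=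
  limn (series (fun n : nat =>
    pochhammer a n * pochhammer b n * pochhammer c n
      / (pochhammer e n * pochhammer f n) * (z ^+ n / n`!%:R))).

(* Main.v *)
From mathcomp Require Import all_boot all_order all_algebra.
From mathcomp Require Import all_classical all_reals all_analysis.
From mathcomp Require Import measurable_realfun ring lra.
Require Import Defs.
Set Implicit Arguments.
Unset Strict Implicit.
Unset Printing Implicit Defensive.
Import Order.TTheory GRing.Theory Num.Theory.
Import numFieldNormedType.Exports.
Local Open Scope classical_set_scope.
Local Open Scope ring_scope.

(* A cyclic product h(x,y)h(y,z)h(z,w)h(w,x) of a symmetric kernel integrates
   to 4 times its integral over the region where x is the least variable.
   There the homogeneity of |s|^(-d) lets the variables be integrated out one
   at a time, using only affine substitutions, Tonelli and the convolution
   identity  x_+^a * x_+^b = B(a+1,b+1) x_+^(a+b+1).  With b = B(1-d,1-d) this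
   gives
     c_4 = (b^2 + 2 b B(1-d,2-2d) + 2 J) / ((1-d)(3-4d)),
     J = \int_(0 < z < y < 1) (1-z)^(-d) y^(-d) (y-z)^(-d) dz dy.
   The beta values are Gamma quotients, and expanding (1-z)^(-d) in its binomial
   series and integrating termwise turns 2J into (1-d)^(-2) times the 3F2. *)

(** All integrals are taken in the nonnegative extended reals, so Tonelli applies at every exchange
    and finiteness appears only with the final values. For fixed x < z the two neighbours y, w > x
    enter through the same function g, hence c_4 = 4 \int_(x<z) g(x,z)^2. Splitting y > x at z gives
    g = b (z-x)^(1-2d) + N(x,z), and the three terms of c_4 come from the expanded square. After the
    inner integrations each term reduces to the power 2-4d of a difference, whose integral
    1/((3-4d)(4-4d)) absorbs the factor 4. The obstacle is N^2, since N is not evaluated: writing it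
    as a double integral and keeping the largest variable for last turns it into a rescaled J. The
    endpoints are separate: at d = 0 the kernel is not a sum of truncated powers on the diagonal,
    and at d = 1/2 sigma vanishes. *)

Local Notation mu := lebesgue_measure.

(** * Affine changes of variables and Tonelli on the line *)

Section lebesgue_integral_over_R.
Context {R : realType}.
Local Open Scope ereal_scope.
Implicit Types f : R -> \bar R.

Lemma measurable_affine (c a : R) : measurable_fun setT (fun x : R => (c * x + a)%R).
Proof. by apply: measurable_funD => //; exact: measurable_funM. Qed.

Lemma lebesgue_measure_affine (c a u v : R) : c != 0%R ->
  `|c|%:E * mu ((fun x : R => (c * x + a)%R) @^-1` `]u, v]) = mu `]u, v]%classic.
Proof.
move=> c0; have [cp|cn|/eqP] := ltgtP 0%R c; last by rewrite eq_sym (negbTE c0).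
- rewrite (_ : _ @^-1` _ = `]((u - a) / c)%R, ((v - a) / c)%R]%classic); last first.
    apply/seteqP; split => x /=; rewrite !in_itv/= ltr_pdivrMr// ler_pdivlMr//;
      by rewrite ltrBlDr lerBrDr mulrC.
  rewrite !lebesgue_measure_itv/= !lte_fin ltr_pM2r ?invr_gt0// ltrD2r.
  case: ifPn => _; last by rewrite mule0.
  by rewrite gtr0_norm// -!EFinB -EFinM; congr EFin; field; exact/lt0r_neq0.
(* A negative slope swaps the endpoints, so the preimage is closed on the left; its length is
   unaffected. *)
- rewrite (_ : _ @^-1` _ = `[((v - a) / c)%R, ((u - a) / c)%R[%classic); last first.
    apply/seteqP; split => x /=; rewrite !in_itv/= ltr_ndivlMr// ler_ndivrMr//;
      by rewrite ltrBlDr lerBrDr mulrC andbC.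
  rewrite !lebesgue_measure_itv/= !lte_fin ltr_nM2r ?invr_lt0// ltrD2r.
  case: ifPn => _; last by rewrite mule0.
  by rewrite ltr0_norm// -!EFinB -EFinM; congr EFin; field.
Qed.

(** Here [nu] stands for an affine push-forward of [mu]: Lebesgue measure is determined by its
    values on half-open intervals, so the substitution rule needs no derivative. *)
Lemma integral_lebesgue_unique (k : {nonneg R})
    (nu : {measure set (measurableTypeR R) -> \bar R}) f :
  (forall u v, k%:num%:E * nu `]u, v]%classic = mu `]u, v]%classic) ->
  measurable_fun setT f -> (forall x, 0 <= f x) ->
  k%:num%:E * \int[nu]_x f x = \int[mu]_x f x.
Proof.
move=> nuE mf f0; rewrite -ge0_integral_mscale//.
apply: eq_measure_integral => A mA _; apply/esym.
by apply: lebesgue_measure_unique => //= _ [[u v] _ <-] /=; exact/esym/nuE.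
Qed.

Lemma integral_affine (c a : R) f : c != 0%R ->
  measurable_fun setT f -> (forall x, 0 <= f x) ->
  `|c|%:E * \int[mu]_x f (c * x + a)%R = \int[mu]_x f x.
Proof.
move=> c0 mf f0.
pose phi (x : measurableTypeR R) : measurableTypeR R := (c * x + a)%R.
have mphi : measurable_fun setT phi by exact: measurable_affine.
have := ge0_integral_pushforward mphi mu measurableT mf (fun y _ => f0 y).
rewrite preimage_setT => /(congr1 (fun z => `|c|%:E * z)) <-.
by apply: (integral_lebesgue_unique (k := NngNum (normr_ge0 c))) => // u v;
  exact: lebesgue_measure_affine.
Qed.

Lemma integral_shift (a : R) f : measurable_fun setT f -> (forall x, 0 <= f x) ->
  \int[mu]_x f (x + a)%R = \int[mu]_x f x.
Proof.
move=> mf f0; rewrite -(@integral_affine 1 a f)// normr1 mul1e.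
by apply: eq_integral => x _; rewrite mul1r.
Qed.

Lemma integral_scale (c : R) f : (0 < c)%R ->
  measurable_fun setT f -> (forall x, 0 <= f x) ->
  c%:E * \int[mu]_x f (c * x)%R = \int[mu]_x f x.
Proof.
move=> c0 mf f0; rewrite -(@integral_affine c 0 f)// ?gt_eqF// gtr0_norm//.
by congr (_ * _); apply: eq_integral => x _; rewrite addr0.
Qed.

Lemma integral_reflect (a : R) f : measurable_fun setT f -> (forall x, 0 <= f x) ->
  \int[mu]_x f (a - x)%R = \int[mu]_x f x.
Proof.
move=> mf f0; rewrite -(@integral_affine (-1) a f)// ?lt_eqF ?ltrN10//.
rewrite normrN1 mul1e.
by apply: eq_integral => x _; rewrite mulN1r addrC.
Qed.

Lemma integral_mull (k : \bar R) f : measurable_fun setT f -> (forall x, 0 <= f x) ->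
  0 <= k -> \int[mu]_x (k * f x) = k * \int[mu]_x f x.
Proof. by move=> mf f0 k0; rewrite ge0_integralZl. Qed.

Lemma integral_mulr (k : \bar R) f : measurable_fun setT f -> (forall x, 0 <= f x) ->
  0 <= k -> \int[mu]_x (f x * k) = \int[mu]_x f x * k.
Proof. by move=> mf f0 k0; rewrite ge0_integralZr. Qed.

Lemma integral_add f g : measurable_fun setT f -> (forall x, 0 <= f x) ->
  measurable_fun setT g -> (forall x, 0 <= g x) ->
  \int[mu]_x (f x + g x) = \int[mu]_x f x + \int[mu]_x g x.
Proof. by move=> mf f0 mg g0; rewrite ge0_integralD. Qed.

Lemma exchange_integral (F : R -> R -> \bar R) :
  measurable_fun setT (fun p : R * R => F p.1 p.2) ->
  (forall x y, 0 <= F x y) ->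
  \int[mu]_x \int[mu]_y F x y = \int[mu]_y \int[mu]_x F x y.
Proof.
move=> mF F0.
exact: (@fubini_tonelli _ _ _ _ _ mu mu (fun p : R * R => F p.1 p.2)).
Qed.

Lemma measurable_integral d (T : measurableType d) (F : T -> R -> \bar R) :
  (forall x y, 0 <= F x y) ->
  measurable_fun setT (fun p : T * R => F p.1 p.2) ->
  measurable_fun setT (fun x => \int[mu]_y F x y).
Proof.
move=> F0 mF.
exact: (@measurable_fun_fubini_tonelli_F _ _ T _ _ mu (fun p : T * R => F p.1 p.2)).
Qed.

End lebesgue_integral_over_R.

(** * Truncated powers *)

Section positive_power.
Context {R : realType}.
Local Open Scope ereal_scope.
Implicit Types a b c x : R.

(* x_+^a: zero for x <= 0, even when a <= 0, so that pospow 0 is the indicator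
   function of ]0, +oo[. *)
Definition pospow a x : \bar R := if (0 < x)%R then (x `^ a)%:E else 0.

Lemma pospow_ge0 a x : 0 <= pospow a x.
Proof. by rewrite /pospow; case: ifP => // _; rewrite lee_fin powR_ge0. Qed.

Lemma pospow_gt0E a x : (0 < x)%R -> pospow a x = (x `^ a)%:E.
Proof. by rewrite /pospow => ->. Qed.

Lemma pospow_le0 a x : (x <= 0)%R -> pospow a x = 0.
Proof. by rewrite /pospow ltNge => ->. Qed.

Lemma pospow0E x : pospow 0 x = (0 < x)%R%:R%:E.
Proof. by rewrite /pospow; case: ifP => // _; rewrite powRr0. Qed.

Lemma pospowD a b x : pospow a x * pospow b x = pospow (a + b) x.
Proof.
rewrite /pospow; case: ifP => [x0|_]; last by rewrite mule0.
by rewrite -EFinM powRD// (gt_eqF x0) implybT.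
Qed.

Lemma pospowM a c x : (0 < c)%R -> pospow a (c * x) = (c `^ a)%:E * pospow a x.
Proof.
move=> c0; rewrite /pospow pmulr_rgt0//; case: ifP => [x0|_]; last by rewrite mule0.
by rewrite powRM ?ltW.
Qed.

Lemma measurable_pospow d (T : measurableType d) a (g : T -> R) :
  measurable_fun setT g -> measurable_fun setT (fun t => pospow a (g t)).
Proof.
move=> mg; apply: (measurableT_comp (f := pospow a)) => //.
apply: measurable_fun_ifT => //.
  exact: measurable_fun_ltr.
by apply/measurable_EFinP.
Qed.

Lemma measurable_comp_fst d1 d2 d3 (T : measurableType d1) (U : measurableType d2)
    (V : measurableType d3) (g : T -> U * V) :
  measurable_fun setT g -> measurable_fun setT (fun t => (g t).1).
Proof. by move=> mg; exact: measurableT_comp. Qed.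

Lemma measurable_comp_snd d1 d2 d3 (T : measurableType d1) (U : measurableType d2)
    (V : measurableType d3) (g : T -> U * V) :
  measurable_fun setT g -> measurable_fun setT (fun t => (g t).2).
Proof. by move=> mg; exact: measurableT_comp. Qed.

Lemma measurable_comp2 d1 d2 d3 d4 (T : measurableType d1) (U : measurableType d2)
    (V : measurableType d3) (W : measurableType d4) (h : U -> V -> W)
    (f : T -> U) (g : T -> V) :
  measurable_fun setT (fun p : U * V => h p.1 p.2) ->
  measurable_fun setT f -> measurable_fun setT g ->
  measurable_fun setT (fun t => h (f t) (g t)).
Proof.
move=> mh mf mg.
exact: (measurableT_comp (f := fun p : U * V => h p.1 p.2) (g := fun t => (f t, g t)) mh
  (measurable_fun_pair mf mg)).
Qed.

End positive_power.

Ltac nonneg_tac := move=> *; repeat first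
  [ exact: pospow_ge0
  | apply: integral_ge0; move=> * | apply: mule_ge0 | apply: adde_ge0
  | by rewrite lee_fin ?expR_ge0 ?powR_ge0 ].

Ltac measurable_step :=
  lazymatch goal with
  | |- measurable_fun _ (fun t => integral _ _ _) =>
      apply: measurable_integral; [by nonneg_tac|]
  | |- measurable_fun _ (fun t => pospow _ _) => apply: measurable_pospow
  | |- measurable_fun _ (pospow _) => exact: (measurable_pospow _ (@measurable_id _ _ setT))
  | |- measurable_fun _ (fun t => (_ * _)%E) => apply: emeasurable_funM
  | |- measurable_fun _ (fun t => (_ - _)%R) => apply: measurable_funB
  | |- measurable_fun _ (fun t => @GRing.add _ _ _) =>
      first [apply: measurable_funD | apply: emeasurable_funD]
  | |- measurable_fun _ (fun t => (_ * _)%R) => apply: measurable_funM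
  | |- measurable_fun _ fst => exact: measurable_fst
  | |- measurable_fun _ snd => exact: measurable_snd
  | |- measurable_fun _ id => exact: measurable_id
  | |- measurable_fun _ (fun t => fst _) => apply: measurable_comp_fst
  | |- measurable_fun _ (fun t => snd _) => apply: measurable_comp_snd
  | |- measurable_fun _ (fun t => t) => exact: measurable_id
  | |- measurable_fun _ _ => first [assumption | exact: measurable_cst]
  end.

Ltac measurable_tac := repeat measurable_step.

(** * Beta integrals as convolutions of truncated powers *)

Section beta_integral.
Context {R : realType}.
Local Open Scope ereal_scope.
Implicit Types a b c x y z : R.

(* The exponents are a and b, so this is Euler's B(a + 1, b + 1); it is +oo when
   the integral diverges. *)
Definition beta_integral a b : \bar R :=
  \int[mu]_t (pospow a (1 - t) * pospow b t).

Lemma beta_integral_ge0 a b : 0 <= beta_integral a b.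
Proof. by rewrite /beta_integral; nonneg_tac. Qed.

(** The substitution y = (x - z) t + z carries ]0, 1[ to ]z, x[. For x <= z the integrand vanishes
    identically, in agreement with [+oo * 0 = 0], so the exponents are arbitrary even when the beta
    integral diverges. *)
Lemma pospow_convolution a b x z :
  \int[mu]_y (pospow a (x - y) * pospow b (y - z)) =
  beta_integral a b * pospow (a + b + 1) (x - z).
Proof.
have [xz|zx] := leP x z.
  rewrite (pospow_le0 (_ + _ + _)) ?subr_le0// mule0 integral0_eq// => y _.
  have [yz|zy] := leP y z; first by rewrite (pospow_le0 b) ?subr_le0// mule0.
  by rewrite pospow_le0 ?mul0e// subr_le0 (le_trans xz)// ltW.
have c0 : (0 < x - z)%R by rewrite subr_gt0.
pose f y := pospow a (x - y) * pospow b (y - z).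
rewrite -/(integral _ _ f) -(@integral_affine _ (x - z) z f) ?gt_eqF//; last 2 first.
- by rewrite /f; measurable_tac.
- by rewrite /f; nonneg_tac.
transitivity ((x - z)%:E * (\int[mu]_t (((x - z) `^ (a + b))%:E *
    (pospow a (1 - t) * pospow b t)))).
  rewrite gtr0_norm//; congr (_ * _); apply: eq_integral => t _; rewrite /f.
  rewrite addrK (_ : x - _ = (x - z) * (1 - t))%R; last by ring.
  rewrite !pospowM// powRD ?(gt_eqF c0) ?implybT// EFinM.
  by rewrite muleACA.
rewrite ge0_integralZl//; last 3 first.
- by measurable_tac.
- by nonneg_tac.
- by rewrite lee_fin powR_ge0.
rewrite pospow_gt0E// [in RHS]powRD ?(gt_eqF c0) ?implybT// powRr1 ?ltW//.
by rewrite -/(beta_integral a b) muleC EFinM -!muleA muleCA; congr (_ * _); rewrite muleC.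
Qed.

Lemma powR_continuous_gt0 a x : (0 < x)%R -> {for x, continuous (fun y : R => y `^ a)%R}.
Proof.
move=> x0; apply/differentiable_continuous/derivable1_diffP.
by apply: derivable_powR; rewrite in_itv/= x0.
Qed.

Lemma integral_powR_itv a u v : (0 < u)%R -> (u < v)%R -> (a + 1 != 0)%R ->
  \int[mu]_(x in `[u, v]) (x `^ a)%:E =
  ((v `^ (a + 1) - u `^ (a + 1)) / (a + 1))%:E.
Proof.
move=> u0 uv a10.
rewrite (@continuous_FTC2 _ _ (fun x => x `^ (a + 1) / (a + 1))%R) //.
- by rewrite -EFinB mulrBl.
- apply: continuous_in_subspaceT => x; rewrite inE/= in_itv/= => /andP[ux _].
  exact/powR_continuous_gt0/lt_le_trans/ux.
- have der x : (0 < x)%R -> {for x, continuous (fun x : R => x `^ (a + 1) / (a + 1))%R}.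
    move=> x0; apply: continuousM; first exact: powR_continuous_gt0.
    exact: cst_continuous.
  split.
  + move=> x; rewrite in_itv/= => /andP[ux _].
    have x0 := lt_trans u0 ux.
    apply: derivableM => //.
    by apply: derivable_powR; rewrite in_itv/= x0.
  + apply: cvg_at_right_filter. exact: der.
  + apply: cvg_at_left_filter. exact/der/lt_trans/uv.
- move=> x; rewrite in_itv/= => /andP[ux _].
  have x0 := lt_trans u0 ux.
  rewrite derive1E deriveM//; last first.
    by apply: derivable_powR; rewrite in_itv/= x0.
  rewrite derive_cst scaler0 add0r.
  rewrite -derive1E powR_derive1 ?in_itv/= ?x0//.
  by rewrite addrK /GRing.scale/= mulrA mulVf// mul1r.
Qed.

(** For a < 0 the integrand is unbounded at 0, so ]0, 1] is exhausted by the intervals [1/(n+1), 1],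
    where the fundamental theorem applies, and monotone convergence gives the limit. *)
Lemma beta_integral0l a : (-1 < a)%R -> beta_integral 0 a = ((a + 1)^-1)%:E.
Proof.
move=> a1; have a10 : (0 < a + 1)%R by rewrite -ltrBlDr sub0r.
pose F (n : nat) : set R := `[(n.+1%:R^-1)%R, 1%R]%classic.
have FU : \bigcup_n F n = `]0%R, 1%R]%classic.
  apply/seteqP; split => [x [n _]|x]; rewrite /F /= !in_itv/=.
    by move=> /andP[nx ->]; rewrite andbT (lt_le_trans _ nx).
  (* The witness works because 1/x < truncn (1/x) + 1. *)
  move=> /andP[x0 x1]; exists (Num.truncn x^-1) => //=; rewrite in_itv/= x1 andbT.
  by rewrite -[leRHS]invrK lef_pV2 ?posrE ?invr_gt0// ltW// truncnS_gt.
have step n : \int[mu]_(x in F n) (x `^ a)%:E =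
    ((1 - n.+1%:R^-1 `^ (a + 1)) / (a + 1))%R%:E.
  (* For n = 0 the interval is the single point 1, and the strict inequality of [integral_powR_itv]
     fails. *)
  have [->|n0] := posnP n.
    by rewrite /F invr1 set_itv1 integral_set1 powR1 subrr mul0r.
  by rewrite /F integral_powR_itv ?powR1 ?gt_eqF// invf_lt1// ltr1n.
transitivity (\int[mu]_(x in `]0%R, 1%R]) (x `^ a)%:E).
  rewrite -integral_itv_bndo_bndc; last first.
    by apply/measurable_funTS/measurable_EFinP.
  rewrite [RHS]integral_mkcond; apply: eq_integral => x _.
  rewrite patchE pospow0E subr_gt0 /pospow; case: ifPn => x0; last first.
    by rewrite mule0 memNset//= in_itv/= (negbTE x0).
  have [x1|x1] := ltP x 1%R; last first.
    by rewrite mul0e memNset//= in_itv/= x0 ltNge x1.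
  by rewrite mul1e mem_set//= in_itv/= x0.
rewrite -FU; apply: (@cvg_unique _ _ (\int[mu]_(x in F i) (x `^ a)%:E @[i --> \oo])) => //.
  apply: ge0_nondecreasing_set_cvg_integral.
  - move=> m n mn; apply/subsetPset => x; rewrite /F /= !in_itv/= => /andP[mx ->].
    rewrite andbT (le_trans _ mx)// lef_pV2 ?posrE// ler_nat//.
  - by move=> n; exact: measurable_itv.
  - by move=> n; apply/measurable_funTS/measurable_EFinP.
  - by move=> n x _; rewrite lee_fin powR_ge0.
rewrite (funext step).
apply: cvg_EFin; first exact: nearW.
rewrite -[X in _ --> X]mul1r; apply: cvgMl.
have : (1%R - n.+1%:R^-1 `^ (a + 1))%R @[n --> \oo] --> (1 - 0 : R)%R; last first.
  by rewrite subr0.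
apply: cvgB; first exact: cvg_cst.
have /cvg_at_rightP := powR_cvg0 a10; apply.
by split => [n|]; [rewrite invr_gt0|exact: cvg_harmonic].
Qed.

End beta_integral.

(** * The Gamma function and its relation to Beta *)

Section gamma_function.
Context {R : realType}.
Local Open Scope ereal_scope.
Implicit Types a b c x y z : R.

(** The extended-valued form of [Gamma], written over the whole line so that Tonelli and convolution
    apply before finiteness is known. *)
Definition gamma_integral a : \bar R :=
  \int[mu]_t (pospow (a - 1) t * (expR (- t))%:E).

Lemma gamma_integral_ge0 a : 0 <= gamma_integral a.
Proof. by rewrite /gamma_integral; nonneg_tac. Qed.

Lemma measurable_expRN d (T : measurableType d) (g : T -> R) :
  measurable_fun setT g -> measurable_fun setT (fun t => (expR (- g t))%:E).
Proof.
move=> mg; apply/measurable_EFinP; apply: (measurableT_comp (f := expR)) => //.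
exact: measurableT_comp.
Qed.

(** With r = s + t the factor e^(-r) leaves the inner integral, and what remains is a convolution of
    truncated powers. *)
Lemma gamma_integralM a b :
  gamma_integral a * gamma_integral b =
  beta_integral (a - 1) (b - 1) * gamma_integral (a + b).
Proof.
pose g c (t : R) := pospow (c - 1) t * (expR (- t))%:E.
have mg c d (T : measurableType d) (f : T -> R) :
    measurable_fun setT f -> measurable_fun setT (fun t => g c (f t)).
  by move=> mf; apply: emeasurable_funM;
    [exact: measurable_pospow|exact: measurable_expRN].
have g0 c t : 0 <= g c t by rewrite /g; nonneg_tac.
have E (r t : R) : g a (r - t)%R * g b t =
    (expR (- r))%:E * (pospow (a - 1) (r - t) * pospow (b - 1) (t - 0)).
  rewrite /g subr0 muleACA -EFinM -expRD (_ : - (r - t) + - t = - r)%R 1?muleC//.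
  by ring.
have m c := mg c _ _ (fun t : R => t) (@measurable_id _ R setT).
transitivity (\int[mu]_t \int[mu]_r (g a (r - t)%R * g b t)).
  rewrite muleC -[RHS](_ : \int[mu]_t (g b t * gamma_integral a) = _).
    by rewrite integral_mulr//; exact: gamma_integral_ge0.
  apply: eq_integral => t _.
  rewrite -[gamma_integral a]/(\int[mu]_s g a s) -(integral_shift (- t) (f := g a))//.
  rewrite -integral_mull; [|apply: mg; measurable_tac|move=> ?; exact: g0|exact: g0].
  by apply: eq_integral => r _; rewrite muleC.
rewrite exchange_integral; last 2 first.
- apply: emeasurable_funM; apply: mg; measurable_tac.
- by move=> t r; exact: mule_ge0.
rewrite /gamma_integral -ge0_integralZl ?beta_integral_ge0//; last 2 first.
- exact: (mg (a + b)%R _ _ id).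
- by move=> t _; exact: g0.
apply: eq_integral => r _; under eq_integral do rewrite E.
rewrite integral_mull; [|by measurable_tac|by nonneg_tac|by rewrite lee_fin expR_ge0].
rewrite pospow_convolution subr0 (_ : a - 1 + (b - 1) + 1 = a + b - 1)%R; last by ring.
by rewrite muleC -muleA.
Qed.

Lemma gamma_integral1 : gamma_integral 1 = 1.
Proof.
rewrite -(@integral_exponential_pdf R 1)//.
transitivity (\int[mu]_(x in `](0:R)%R, +oo[) (expR (- x))%:E).
  rewrite [RHS]integral_mkcond; apply: eq_integral => x _.
  rewrite patchE subrr pospow0E; case: ltP => x0.
    by rewrite mul1e mem_set//= in_itv/= x0.
  by rewrite mul0e memNset//= in_itv/= andbT; apply/negP; rewrite -leNgt.
rewrite integral_itv_obnd_cbnd; last first.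
  by apply: measurable_funTS; exact: measurable_expRN.
rewrite [LHS]integral_mkcond; apply: eq_integral => x _.
rewrite /exponential_pdf !patchE; case: ifPn => // _.
by rewrite mul1r mulN1r.
Qed.

(** The recursion without integration by parts: it is the product formula at (1, a), since B(1, a) =
    1/a. *)
Lemma gamma_integral_recl a : (0 < a)%R ->
  gamma_integral a = (a^-1)%:E * gamma_integral (a + 1).
Proof.
move=> a0; have := gamma_integralM 1 a.
rewrite gamma_integral1 mul1e subrr beta_integral0l; last by rewrite ltrBrDr addNr.
by rewrite subrK addrC.
Qed.

Lemma gamma_integralS a : (0 < a)%R ->
  gamma_integral (a + 1) = a%:E * gamma_integral a.
Proof.
move=> a0; rewrite (gamma_integral_recl a0) muleA -EFinM divff ?gt_eqF//.
by rewrite mul1e.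
Qed.

(** On ]0, 1[ the exponential is at least e^(-1), and t^(a-1) has integral 1/a there. *)
Lemma gamma_integral_gt0 a : (0 < a)%R -> 0 < gamma_integral a.
Proof.
move=> a0; have a1 : (-1 < a - 1)%R by rewrite ltrBrDr addNr.
apply: (@lt_le_trans _ _ ((expR (-1))%:E * beta_integral 0 (a - 1))).
  by rewrite beta_integral0l// subrK -EFinM lte_fin mulr_gt0 ?expR_gt0 ?invr_gt0.
rewrite /beta_integral -integral_mull;
  [|by measurable_tac|by nonneg_tac|by rewrite lee_fin expR_ge0].
apply: ge0_le_integral => //.
- by move=> x _; nonneg_tac.
- by measurable_tac.
- by apply: emeasurable_funM; [measurable_tac|exact: measurable_expRN].
- move=> x _; rewrite pospow0E subr_gt0 muleC.
  case: ltP => x1; last by rewrite !mul0e; nonneg_tac.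
  by rewrite mul1e lee_wpmul2l ?pospow_ge0// lee_fin ler_expR lerN2 ltW.
Qed.

Lemma gamma_integral_nat (n : nat) : gamma_integral (n.+1%:R) = n`!%:R%:E.
Proof.
elim: n => [|n IH]; first by rewrite gamma_integral1.
by rewrite -natr1 gamma_integralS// IH -EFinM -natrM factS.
Qed.

Lemma gamma_integral_fin_num a : (0 < a)%R -> gamma_integral a \is a fin_num.
Proof.
move=> a0; rewrite gamma_integral_recl//.
rewrite fin_numM// ge0_fin_numE; last by rewrite /gamma_integral; nonneg_tac.
(* The recursion has raised the exponent from a - 1 to a > 0, so t^a <= 1 + t^(n+1) with n + 1 > a;
   both majorants give Gamma values at integers. *)
pose n := Num.truncn a.
apply: (@le_lt_trans _ _ (gamma_integral 1 + gamma_integral n.+2%:R)); last first.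
  by rewrite gamma_integral1 gamma_integral_nat -EFinD ltry.
have m c : measurable_fun setT (fun t : R => pospow (c - 1) t * (expR (- t))%:E).
  by apply: emeasurable_funM; [measurable_tac|exact: measurable_expRN].
rewrite -integral_add; [|exact: m|by nonneg_tac|exact: m|by nonneg_tac].
apply: ge0_le_integral => //.
- by move=> x _; nonneg_tac.
- exact: m.
- by apply: emeasurable_funD; exact: m.
- move=> x _; rewrite -ge0_muleDl ?pospow_ge0//; apply: lee_wpmul2r.
    by rewrite lee_fin expR_ge0.
  rewrite addrK subrr /pospow; case: ifPn => [x0|]; last by rewrite adde0.
  rewrite powRr0 -EFinD lee_fin -natr1 addrK.
  have [x1|x1] := leP x 1%R.
    rewrite (@le_trans _ _ 1%R) ?lerDl ?powR_ge0//.
    by rewrite -(powRr0 x) ger_powR ?x0 ?x1// ltW.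
  rewrite (@le_trans _ _ (x `^ n.+1%:R))%R ?lerDr//.
  by rewrite ler_powR ?(ltW x1)// ltW// truncnS_gt.
Qed.

Lemma gamma_integralE a : (0 < a)%R -> gamma_integral a = (Gamma a)%:E.
Proof.
move=> a0; rewrite /Gamma /Rintegral.
rewrite (_ : integral _ _ _ = gamma_integral a) ?fineK ?gamma_integral_fin_num//.
rewrite integral_mkcond; apply: eq_integral => x _.
rewrite patchE /pospow; case: ltP => x0.
  by rewrite mem_set//= in_itv/= x0.
by rewrite mul0e memNset//= in_itv/= andbT; apply/negP; rewrite -leNgt.
Qed.

Lemma Gamma_gt0 a : (0 < a)%R -> (0 < Gamma a)%R.
Proof. by move=> a0; rewrite -lte_fin -gamma_integralE ?gamma_integral_gt0. Qed.

Lemma Gamma1 : Gamma (1:R) = 1%R.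
Proof. by apply/EFin_inj; rewrite -gamma_integralE ?gamma_integral1. Qed.

Lemma GammaS a : (0 < a)%R -> Gamma (a + 1) = (a * Gamma a)%R.
Proof.
move=> a0; apply/EFin_inj.
by rewrite EFinM -!gamma_integralE ?addr_gt0// gamma_integralS.
Qed.

Lemma Gamma_nat (n : nat) : Gamma (n.+1%:R : R) = n`!%:R%R.
Proof. by apply/EFin_inj; rewrite -gamma_integralE ?gamma_integral_nat. Qed.

Lemma Gamma_pochhammer a (n : nat) : (0 < a)%R ->
  Gamma (a + n%:R) = (pochhammer a n * Gamma a)%R.
Proof.
move=> a0; elim: n => [|n IH]; first by rewrite addr0 /pochhammer big_ord0 mul1r.
rewrite -natr1 addrA GammaS; last by rewrite ltr_pwDl.
rewrite IH /pochhammer big_ord_recr/=.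
by rewrite mulrA; congr (_ * _)%R; rewrite mulrC.
Qed.

Lemma beta_integralE a b : (0 < a)%R -> (0 < b)%R ->
  beta_integral (a - 1) (b - 1) = (Gamma a * Gamma b / Gamma (a + b))%:E.
Proof.
move=> a0 b0; have ab0 : (0 < a + b)%R by rewrite addr_gt0.
have := gamma_integralM a b; rewrite !gamma_integralE// => E.
have G0 := Gamma_gt0 ab0.
rewrite !EFinM E -muleA -EFinM divff ?gt_eqF// mule1//.
Qed.

End gamma_function.

(** * Symmetry reduction of a four-cycle of a symmetric kernel *)

Section four_cycle.
Context {R : realType}.
Local Open Scope ereal_scope.
Local Notation th := (@pospow R 0).

Lemma integral_split_at (x : R) (f : R -> \bar R) :
  measurable_fun setT f -> (forall y, 0 <= f y) ->
  \int[mu]_y f y =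
  \int[mu]_y (th (y - x) * f y) + \int[mu]_y (th (x - y) * f y).
Proof.
move=> mf f0.
have m1 : measurable_fun setT (fun y : R => th (y - x) * f y) by measurable_tac.
have m2 : measurable_fun setT (fun y : R => th (x - y) * f y) by measurable_tac.
rewrite -integral_add; [|exact: m1|by nonneg_tac|exact: m2|by nonneg_tac].
(* Both indicators vanish at y = x, so this null point is removed before comparing integrands. *)
have mx : measurable ([set: R] `\ x) by apply: measurableD.
rewrite -(@integral_setD1 R _ x setT mx); last exact: measurable_funTS.
rewrite -[RHS](@integral_setD1 R _ x setT mx); last first.
  by apply: measurable_funTS; exact: emeasurable_funD.
apply: eq_integral => y; rewrite inE/= => -[_ /eqP yx].
rewrite !pospow0E !subr_gt0.
by case: (ltgtP x y) yx => // _ _; rewrite mul1e mul0e ?adde0 ?add0e.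
Qed.

Lemma integral_mull2 (k : \bar R) (G : R -> R -> \bar R) :
  measurable_fun setT (fun p : R * R => G p.1 p.2) -> (forall x y, 0 <= G x y) ->
  0 <= k ->
  \int[mu]_x \int[mu]_y (k * G x y) = k * \int[mu]_x \int[mu]_y G x y.
Proof.
move=> mG G0 k0; rewrite -integral_mull//; last 2 first.
- exact: measurable_integral.
- by move=> x; exact: integral_ge0.
apply: eq_integral => x _; rewrite integral_mull//.
by apply: (measurable_comp2 mG); measurable_tac.
Qed.

(** Exchanging the integrals and renaming the variables turns the half y < x into the half x < y. *)
Lemma integral_symmetric (F : R -> R -> \bar R) :
  measurable_fun setT (fun p : R * R => F p.1 p.2) ->
  (forall x y, 0 <= F x y) -> (forall x y, F x y = F y x) ->
  \int[mu]_x \int[mu]_y F x y =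
  2%:E * \int[mu]_x \int[mu]_y (th (y - x) * F x y).
Proof.
move=> mF F0 FC.
have mF2 d (T : measurableType d) (f g : T -> R) : measurable_fun setT f ->
    measurable_fun setT g -> measurable_fun setT (fun t => F (f t) (g t)).
  by move=> mf mg; exact: (measurable_comp2 mF mf mg).
have F0' x y z : 0 <= th z * F x y by rewrite mule_ge0 ?pospow_ge0.
transitivity (\int[mu]_x (\int[mu]_y (th (y - x) * F x y) +
    \int[mu]_y (th (x - y) * F x y))).
  apply: eq_integral => x _; apply: integral_split_at => //.
  by apply: mF2; measurable_tac.
have m1 : measurable_fun setT (fun p : R * R => th (p.2 - p.1) * F p.1 p.2).
  by measurable_tac; apply: mF2; measurable_tac.
have m2 : measurable_fun setT (fun p : R * R => th (p.1 - p.2) * F p.1 p.2).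
  by measurable_tac; apply: mF2; measurable_tac.
rewrite integral_add; last 4 first.
- by apply: measurable_integral m1 => x y; exact: F0'.
- by move=> x; apply: integral_ge0.
- by apply: measurable_integral m2 => x y; exact: F0'.
- by move=> x; apply: integral_ge0.
rewrite [X in _ + X]exchange_integral//.
rewrite [X in _ + X](_ : _ = \int[mu]_x \int[mu]_y (th (y - x) * F x y)).
  by rewrite mule_natl mule2n.
by apply: eq_integral => y _; apply: eq_integral => x _; rewrite FC.
Qed.

Variable h : R -> R -> \bar R.
Hypothesis mh : measurable_fun setT (fun p : R * R => h p.1 p.2).
Hypothesis h0 : forall x y, 0 <= h x y.
Hypothesis hC : forall x y, h x y = h y x.

Let F x y z w := h x y * h y z * h z w * h w x.

Let F0 x y z w : 0 <= F x y z w.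
Proof. by rewrite /F !mule_ge0. Qed.

Let mh2 d (T : measurableType d) (f g : T -> R) : measurable_fun setT f ->
  measurable_fun setT g -> measurable_fun setT (fun t => h (f t) (g t)).
Proof. by move=> mf mg; exact: (measurable_comp2 mh mf mg). Qed.

Let mF d (T : measurableType d) (x y z w : T -> R) :
  measurable_fun setT x -> measurable_fun setT y ->
  measurable_fun setT z -> measurable_fun setT w ->
  measurable_fun setT (fun t => F (x t) (y t) (z t) (w t)).
Proof. by move=> *; rewrite /F; repeat (apply: emeasurable_funM || apply: mh2). Qed.

Let rot x y z w : F x y z w = F y z w x.
Proof. by rewrite /F (ACl (2*3*4*1)). Qed.

Let flip x y z w : F x y z w = F x w z y.
Proof.
by rewrite /F (hC x w) (hC w z) (hC z y) (hC y x) (ACl (4*3*2*1)).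
Qed.

Ltac ntac := move=> *; repeat first
  [ exact: pospow_ge0 | apply: integral_ge0; move=> *
  | exact: F0 | exact: h0 | apply: mule_ge0 ].
Ltac mtac := repeat
  lazymatch goal with
  | |- measurable_fun _ (fun t => F _ _ _ _) => apply: mF
  | |- measurable_fun _ (fun t => h _ _) => apply: mh2
  | |- measurable_fun _ (h _) => exact: (mh2 (measurable_cst _) (@measurable_id _ _ setT))
  | |- measurable_fun _ (fun t => integral _ _ _) =>
      apply: measurable_integral; [by ntac|]
  | |- _ => measurable_step
  end.

(* Symmetry in (x, z), in (y, w) and under the rotation of the cycle lets one
   assume x < z, y < w and x < y in turn, each at the price of a factor 2; the
   condition y < w is then given back. *)
Lemma integral_four_cycle :
  \int[mu]_x \int[mu]_y \int[mu]_z \int[mu]_w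
    (h x y * h y z * h z w * h w x) =
  4%:E * \int[mu]_x \int[mu]_z (th (z - x) *
    (\int[mu]_y (th (y - x) * (h x y * h y z))) ^+ 2).
Proof.
pose P x y := \int[mu]_z \int[mu]_w (th (z - x) * (th (w - y) * F x y z w)).
have P0 x y : 0 <= P x y by rewrite /P; ntac.
have mP : measurable_fun setT (fun p : R * R => P p.1 p.2).
  rewrite /P; apply: measurable_integral; first by ntac.
  apply: measurable_integral; first by ntac.
  by mtac.
(* A rotation followed by a reflection of the cycle swaps x with y and z with w, hence also the two
   conditions x < z and y < w. *)
have PC x y : P x y = P y x.
  rewrite [RHS]/P exchange_integral; [|by mtac|by ntac].
  apply: eq_integral => z _; apply: eq_integral => w _.
  by rewrite muleCA; congr (_ * (_ * _)); rewrite [RHS]rot flip.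
(* The opposite vertices x and z are made consecutive so that [integral_symmetric] can act on this
   pair. *)
transitivity (\int[mu]_x \int[mu]_z \int[mu]_y \int[mu]_w F x y z w).
  apply: eq_integral => x _; apply: exchange_integral; [by mtac|by ntac].
rewrite integral_symmetric; last 3 first.
- by mtac.
- by ntac.
- by move=> x z; apply: eq_integral => y _; apply: eq_integral => w _; rewrite rot flip -rot.
transitivity (4%:E * \int[mu]_x \int[mu]_y P x y).
  rewrite (_ : 4%:E = 2%:E * 2%:E); last by rewrite -EFinM; congr EFin; ring.
  rewrite -muleA; congr (_ * _).
  rewrite -integral_mull; [|by rewrite /P; mtac|by rewrite /P; ntac|by []].
  apply: eq_integral => x _.
  rewrite /P exchange_integral; [|by mtac|by ntac].
  rewrite -integral_mull; [|by mtac|by ntac|by []].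
  apply: eq_integral => z _.
  rewrite integral_symmetric; [|by mtac|by ntac|by move=> y w; rewrite flip].
  by rewrite muleCA integral_mull2; [|by mtac|by ntac|by ntac].
rewrite (integral_symmetric mP P0 PC); congr (_ * _).
rewrite -integral_mull; [|by rewrite /P; mtac|by rewrite /P; ntac|by []].
apply: eq_integral => x _.
transitivity (2%:E * \int[mu]_z \int[mu]_y \int[mu]_w
    (th (y - x) * (th (z - x) * (th (w - y) * F x y z w)))).
  congr (_ * _); rewrite exchange_integral; [|by mtac|by ntac].
  by apply: eq_integral => y _; rewrite -integral_mull2; [|by mtac|by ntac|by ntac].
rewrite -integral_mull; [|by mtac|by ntac|by []].
apply: eq_integral => z _.
pose g y := th (y - x) * (h x y * h y z).
have mg : measurable_fun setT g by rewrite /g; mtac.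
have g0 y : 0 <= g y by rewrite /g; ntac.
(* From x < y < w follows x < w, so the indicator of x < w may be inserted; both neighbours of x
   then carry the same factor [g]. *)
transitivity (2%:E * \int[mu]_y \int[mu]_w (th (z - x) * (th (w - y) * (g y * g w)))).
  apply: (congr1 (fun u => 2%:E * u)).
  apply: eq_integral => y _; apply: eq_integral => w _.
  rewrite [LHS]muleCA; congr (_ * _); rewrite [LHS]muleCA /F /g (hC z w) (hC w x).
  rewrite !pospow0E !subr_gt0.
  case: (ltP y w) => [yw|_]; last by rewrite !mul0e.
  case: (ltP x y) => [xy|_]; last by rewrite !mul0e.
  by rewrite (lt_trans xy yw) !mul1e -muleA (muleC (h w z)).
rewrite integral_mull2; [|by rewrite /g; mtac|by rewrite /g; ntac|by ntac].
rewrite muleCA; congr (_ * _).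
(* Read backwards, this spends the third factor 2 on removing y < w, which leaves a square and the
   constant 4. *)
rewrite -(integral_symmetric (F := fun y w => g y * g w)); last 3 first.
- apply: emeasurable_funM.
    by apply: (measurableT_comp mg); measurable_tac.
  by apply: (measurableT_comp mg); measurable_tac.
- by move=> y w; rewrite mule_ge0.
- by move=> y w; rewrite muleC.
rewrite expe2 -integral_mulr; [|exact: mg|exact: g0|by apply: integral_ge0 => y _; exact: g0].
by apply: eq_integral => y _; rewrite integral_mull; [|exact: mg|exact: g0|exact: g0].
Qed.

End four_cycle.

(** * From the cube integral to a four-cycle over the whole line *)

Section cyclic_integral_reduction.
Context {R : realType}.
Local Open Scope ereal_scope.
Local Notation th := (@pospow R 0).
Variable d : R.
Hypothesis d0 : (0 < d)%R.
Local Notation p := (@pospow R (- d)).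

(* An indicator is idempotent, so each variable of a cyclic product may carry it
   in both of its kernels. *)
Definition unit_itv_indic (x : R) : \bar R := th x * th (1 - x).
Local Notation chi := unit_itv_indic.

Definition riesz_kernel (x y : R) : \bar R :=
  chi x * chi y * (p (x - y) + p (y - x)).
Local Notation h := riesz_kernel.

Lemma unit_itv_indic_ge0 x : 0 <= chi x.
Proof. by rewrite /unit_itv_indic; nonneg_tac. Qed.

Lemma riesz_kernel_ge0 x y : 0 <= h x y.
Proof.
by rewrite /riesz_kernel /unit_itv_indic; nonneg_tac.
Qed.

Lemma riesz_kernelC x y : h x y = h y x.
Proof. by rewrite /riesz_kernel (muleC (chi x)) addeC. Qed.

Lemma measurable_unit_itv_indic e (T : measurableType e) (f : T -> R) :
  measurable_fun setT f -> measurable_fun setT (fun t => chi (f t)).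
Proof. by move=> mf; rewrite /unit_itv_indic; measurable_tac. Qed.

Lemma measurable_riesz_kernel e (T : measurableType e) (f g : T -> R) :
  measurable_fun setT f -> measurable_fun setT g ->
  measurable_fun setT (fun t => h (f t) (g t)).
Proof.
by move=> mf mg; rewrite /riesz_kernel /unit_itv_indic; measurable_tac.
Qed.

Lemma integral_unit_itv (g : R -> \bar R) : measurable_fun setT g ->
  \int[mu]_(x in `[0%R, 1%R]) g x = \int[mu]_x (chi x * g x).
Proof.
move=> mg; rewrite integral_itv_bndoo; last exact: measurable_funTS.
rewrite integral_mkcond; apply: eq_integral => x _.
rewrite patchE /unit_itv_indic !pospow0E subr_gt0.
rewrite (_ : (x \in _) = (0 < x)%R && (x < 1)%R); last first.
  by apply/idP/idP; rewrite inE/= in_itv/=.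
by case: ltP => _; case: ltP => _; rewrite ?mul1e ?mul0e.
Qed.

(** At s = 0 both sides are 0 because d > 0; for d = 0 the left side would be 1, which is why that
    case is treated apart. *)
Lemma powR_norm_pospow (s : R) : (`|s| `^ (- d))%:E = p s + p (- s).
Proof.
rewrite /pospow oppr_gt0; case: (ltgtP s 0%R) => [s0|s0|->].
- by rewrite add0e ltr0_norm.
- by rewrite adde0 gtr0_norm.
- by rewrite normr0 powR0 ?adde0// oppr_eq0 gt_eqF.
Qed.

Lemma cyclic_kernel4 (x y z w : R) :
  (cyclic_kernel d 4 [:: x; y; z; w])%:E =
  (p (x - y) + p (y - x)) * (p (y - z) + p (z - y)) *
  (p (z - w) + p (w - z)) * (p (w - x) + p (x - w)).
Proof.
rewrite /cyclic_kernel !big_ord_recr big_ord0/= mul1r !EFinM.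
by rewrite !powR_norm_pospow !opprB.
Qed.

(** Stated for abstract values so that the permutation acts on twelve atoms, pairing the two copies
    of each indicator. *)
Lemma mule_idempotent_cycle (a b c e f g k l : \bar R) :
  a * a = a -> b * b = b -> c * c = c -> e * e = e ->
  a * b * f * (b * c * g) * (c * e * k) * (e * a * l) =
  a * (b * (c * (e * (f * g * k * l)))).
Proof.
move=> aa bb cc ee.
by rewrite [LHS](AC (3*3*3*3) ((1*11)*((2*4)*((5*7)*((8*10)*(3*6*9*12))))))/= aa bb cc ee.
Qed.

Lemma rosenblatt_c4E : rosenblatt_c d 4 =
  \int[mu]_x \int[mu]_y \int[mu]_z \int[mu]_w (h x y * h y z * h z w * h w x).
Proof.
pose K x y z w := (p (x - y) + p (y - x)) * (p (y - z) + p (z - y)) *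
  (p (z - w) + p (w - z)) * (p (w - x) + p (x - w)).
have K0 x y z w : 0 <= K x y z w.
  by rewrite /K; nonneg_tac.
have mK e (T : measurableType e) (x y z w : T -> R) :
    measurable_fun setT x -> measurable_fun setT y ->
    measurable_fun setT z -> measurable_fun setT w ->
    measurable_fun setT (fun t => K (x t) (y t) (z t) (w t)).
  by move=> *; rewrite /K; measurable_tac.
have mchi e (T : measurableType e) := @measurable_unit_itv_indic e T.
have chi0 := unit_itv_indic_ge0.
have I0 (f : R -> \bar R) : (forall x, 0 <= f x) -> 0 <= \int[mu]_x f x.
  by move=> f0; apply: integral_ge0.
transitivity (\int[mu]_(x in `[0%R, 1%R]) \int[mu]_(y in `[0%R, 1%R])
   \int[mu]_(z in `[0%R, 1%R]) \int[mu]_(w in `[0%R, 1%R]) K x y z w).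
  apply: eq_integral => x _; apply: eq_integral => y _.
  apply: eq_integral => z _; apply: eq_integral => w _.
  exact: cyclic_kernel4.
pose K1 x y z w := chi x * (chi y * (chi z * (chi w * K x y z w))).
transitivity (\int[mu]_x \int[mu]_y \int[mu]_z \int[mu]_w K1 x y z w); last first.
  apply: eq_integral => x _; apply: eq_integral => y _.
  apply: eq_integral => z _; apply: eq_integral => w _.
  rewrite /K1 /K /riesz_kernel.
  have chi_idem u : chi u * chi u = chi u.
    by rewrite /unit_itv_indic muleACA !pospowD addr0.
  exact/esym/mule_idempotent_cycle.
(* Replacing [0, 1] by [chi] requires measurability of the remaining inner integral at each level,
   so these partial integrals are named from the inside out. *)
pose J3 x y z := \int[mu]_w (chi w * K x y z w).
pose J2 x y := \int[mu]_z (chi z * J3 x y z).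
pose J1 x := \int[mu]_y (chi y * J2 x y).
have J30 x y z : 0 <= J3 x y z by rewrite /J3; apply: I0 => w; rewrite mule_ge0.
have J20 x y : 0 <= J2 x y by rewrite /J2; apply: I0 => w; rewrite mule_ge0.
have J10 x : 0 <= J1 x by rewrite /J1; apply: I0 => w; rewrite mule_ge0.
have mJ3 e (T : measurableType e) (x y z : T -> R) :
    measurable_fun setT x -> measurable_fun setT y -> measurable_fun setT z ->
    measurable_fun setT (fun t => J3 (x t) (y t) (z t)).
  move=> mx my mz; rewrite /J3.
  apply: measurable_integral; first by move=> t w; rewrite mule_ge0.
  apply: emeasurable_funM; [apply: mchi|apply: mK]; measurable_tac;
    by apply: measurableT_comp => //; measurable_tac.
have mJ2 e (T : measurableType e) (x y : T -> R) :
    measurable_fun setT x -> measurable_fun setT y ->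
    measurable_fun setT (fun t => J2 (x t) (y t)).
  move=> mx my; rewrite /J2.
  apply: measurable_integral; first by move=> t w; rewrite mule_ge0.
  apply: emeasurable_funM; [apply: mchi|apply: mJ3]; measurable_tac;
    by apply: measurableT_comp => //; measurable_tac.
have mJ1 : measurable_fun setT J1.
  rewrite /J1.
  apply: measurable_integral; first by move=> t w; rewrite mule_ge0.
  by apply: emeasurable_funM; [apply: mchi|apply: mJ2]; measurable_tac.
transitivity (\int[mu]_x (chi x * J1 x)).
  rewrite -integral_unit_itv; last exact: mJ1.
  apply: eq_integral => x _.
  rewrite /J1 -integral_unit_itv; last exact: mJ2.
  apply: eq_integral => y _.
  rewrite /J2 -integral_unit_itv; last exact: mJ3.
  apply: eq_integral => z _.
  by rewrite /J3 -integral_unit_itv//; exact: mK.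
apply: eq_integral => x _.
rewrite /J1 -integral_mull; last 3 first.
- by apply: emeasurable_funM; [exact: mchi|exact: mJ2].
- by move=> y; rewrite mule_ge0.
- exact: chi0.
apply: eq_integral => y _.
rewrite muleA /J2 -integral_mull; last 3 first.
- by apply: emeasurable_funM; [exact: mchi|exact: mJ3].
- by move=> z; rewrite mule_ge0.
- by do ?[exact: chi0|apply: mule_ge0].
apply: eq_integral => z _.
rewrite muleA /J3 -integral_mull; last 3 first.
- by apply: emeasurable_funM; [exact: mchi|exact: mK].
- by move=> w; rewrite mule_ge0.
- by do ?[exact: chi0|apply: mule_ge0].
by apply: eq_integral => w _; rewrite /K1 !muleA.
Qed.

End cyclic_integral_reduction.

(** * Evaluation tools: homogeneity and kernel composition *)

Section four_cycle_evaluation.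
Context {R : realType}.
Local Open Scope ereal_scope.
Local Notation th := (@pospow R 0).

Lemma beta_integralC (a b : R) : beta_integral a b = beta_integral b a.
Proof.
rewrite /beta_integral -(@integral_reflect R 1); [|by measurable_tac|by nonneg_tac].
by apply: eq_integral => t _; rewrite subKr muleC.
Qed.

(** Two convolutions with [th], the truncated power of exponent 0, raise s to s + 1 and then to s +
    2. *)
Lemma integral_pospow_difference (s : R) : (-1 < s)%R ->
  \int[mu]_x \int[mu]_z (th x * (th (1 - z) * pospow s (z - x))) =
  (((s + 1) * (s + 2))^-1)%:E.
Proof.
move=> s1.
transitivity (\int[mu]_x (((s + 1)^-1)%:E * (pospow (s + 1) (1 - x) * th (x - 0)))).
  apply: eq_integral => x _.
  rewrite integral_mull; [|by measurable_tac|by nonneg_tac|by nonneg_tac].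
  by rewrite pospow_convolution beta_integral0l// add0r subr0 muleC muleA.
rewrite integral_mull; [|by measurable_tac|by nonneg_tac|]; last first.
  by rewrite lee_fin invr_ge0 -lerBlDr sub0r ltW.
rewrite pospow_convolution beta_integralC beta_integral0l; last by lra.
rewrite addr0 subr0 pospow_gt0E// powR1 mule1 -EFinM; congr EFin.
rewrite invfM; congr (_ * _^-1)%R; ring.
Qed.

Lemma integral_add2 (F G : R -> R -> \bar R) :
  measurable_fun setT (fun p : R * R => F p.1 p.2) -> (forall x y, 0 <= F x y) ->
  measurable_fun setT (fun p : R * R => G p.1 p.2) -> (forall x y, 0 <= G x y) ->
  \int[mu]_x \int[mu]_y (F x y + G x y) =
  \int[mu]_x \int[mu]_y F x y + \int[mu]_x \int[mu]_y G x y.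
Proof.
move=> mF F0 mG G0; rewrite -integral_add; last 4 first.
- exact: measurable_integral.
- by move=> x; exact: integral_ge0.
- exact: measurable_integral.
- by move=> x; exact: integral_ge0.
apply: eq_integral => x _; apply: integral_add => //.
- by apply: (measurable_comp2 mF); measurable_tac.
- by apply: (measurable_comp2 mG); measurable_tac.
Qed.

Variable d : R.
Local Notation p := (@pospow R (- d)).
Local Notation q := (@pospow R (1 - 2 * d)).
Local Notation b := (@beta_integral R (- d) (- d)).

(* The integral J of the header, which nested_integral_scale transports from
   [0, 1] to [x, w]. *)
Definition nested_integral : \bar R :=
  \int[mu]_z \int[mu]_y (th z * p (1 - z) * (th (1 - y) * (p y * p (y - z)))).

Lemma nested_integral_ge0 : 0 <= nested_integral.
Proof. by rewrite /nested_integral; nonneg_tac. Qed.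

(** Three kernels of degree -d and two integrations give homogeneity of degree 2 - 3d. *)
Lemma nested_integral_scale (x w : R) :
  \int[mu]_z \int[mu]_y (th (z - x) * p (w - z) *
    (th (w - y) * (p (y - x) * p (y - z)))) =
  nested_integral * pospow (2 - 3 * d) (w - x).
Proof.
have [wx|xw] := leP w x.
  rewrite (pospow_le0 (2 - 3 * d)) ?subr_le0// mule0.
  apply: integral0_eq => z _; apply: integral0_eq => y _.
  rewrite pospow0E subr_gt0; case: (ltP x z) => [xz|_]; last by rewrite !mul0e.
  by rewrite (pospow_le0 _ (x := w - z)) ?mule0 ?mul0e// subr_le0 (le_trans wx)// ltW.
pose c := (w - x)%R; have c0 : (0 < c)%R by rewrite subr_gt0.
pose f z y := th (z - x) * p (w - z) * (th (w - y) * (p (y - x) * p (y - z))).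
have f0 z y : 0 <= f z y by rewrite /f; nonneg_tac.
rewrite -(@integral_affine R c x (fun z => \int[mu]_y f z y)); last 3 first.
- by rewrite gt_eqF.
- by apply: measurable_integral => //; rewrite /f; measurable_tac.
- by move=> z; apply: integral_ge0.
rewrite gtr0_norm// pospow_gt0E// /nested_integral.
(* One factor c for each of the two substitutions, the rest for the three kernels. *)
have cE : (c `^ (2 - 3 * d))%:E = c%:E * (c%:E * (c `^ (- (3 * d)))%:E).
  rewrite -!EFinM; congr EFin.
  rewrite powRD ?(gt_eqF c0) ?implybT// mulrA; congr (_ * _)%R.
  by rewrite (_ : 2 = 1 + 1)%R ?powRD ?(gt_eqF c0) ?implybT ?powRr1 ?ltW//; ring.
rewrite cE [RHS]muleC -muleA -muleA; congr (_ * _).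
rewrite muleA -integral_mull2; last 3 first.
- by measurable_tac.
- by nonneg_tac.
- by rewrite mule_ge0// lee_fin ?powR_ge0 ?ltW.
apply: eq_integral => z _.
rewrite -(@integral_affine R c x (f (c * z + x)%R)); last 3 first.
- by rewrite gt_eqF.
- by rewrite /f; measurable_tac.
- by [].
rewrite gtr0_norm// -integral_mull; last 3 first.
- by rewrite /f; measurable_tac.
- by move=> y; exact: f0.
- by rewrite lee_fin ltW.
apply: eq_integral => y _; rewrite -muleA; congr (_ * _); rewrite /f.
rewrite !addrK (_ : w - (c * z + x) = c * (1 - z))%R; last by rewrite /c; ring.
rewrite (_ : w - (c * y + x) = c * (1 - y))%R; last by rewrite /c; ring.
rewrite (_ : c * y + x - (c * z + x) = c * (y - z))%R; last by ring.
rewrite !pospowM// powRr0 !mul1e.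
rewrite (_ : (c `^ (- (3 * d)))%:E = (c `^ (- d))%:E * ((c `^ (- d))%:E * (c `^ (- d))%:E)).
  by rewrite [LHS](AC (1*2*(1*(2*2))) (2*(5*7)*(1*3*(4*(6*8)))))/=.
by rewrite -!EFinM -!powRD ?(gt_eqF c0) ?implybT//; congr (_ `^ _)%:E; ring.
Qed.

Definition tail_integral (x z : R) : \bar R :=
  \int[mu]_y (th (1 - y) * (p (y - x) * p (y - z))).
Local Notation N := tail_integral.

Lemma tail_integral_ge0 x z : 0 <= N x z.
Proof. by rewrite /tail_integral; nonneg_tac. Qed.

Lemma measurable_tail_integral e (T : measurableType e) (f g : T -> R) :
  measurable_fun setT f -> measurable_fun setT g ->
  measurable_fun setT (fun t => N (f t) (g t)).
Proof.
move=> mf mg; rewrite /tail_integral.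
apply: measurable_integral; first by nonneg_tac.
apply: emeasurable_funM; first by measurable_tac.
have m1 : measurable_fun setT (fun t : T * R => f t.1) by exact: measurableT_comp.
have m2 : measurable_fun setT (fun t : T * R => g t.1) by exact: measurableT_comp.
by measurable_tac.
Qed.

(* For y > x, either y lies between x and z, which is a beta convolution, or y
   lies above z, which is the tail integral. *)
Lemma riesz_kernel_composition (x z : R) :
  th (z - x) * (\int[mu]_y (th (y - x) *
    (riesz_kernel d x y * riesz_kernel d y z))) ^+ 2 =
  th x * (th (1 - z) * (th (z - x) * (b * q (z - x) + N x z) ^+ 2)).
Proof.
have [zx|xz] := leP z x.
  by rewrite (pospow_le0 0 (x := z - x)) ?subr_le0// !(mul0e, mule0).
rewrite [th (z - x)]pospow_gt0E ?subr_gt0// powRr0 !mul1e.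
have [x0|x0] := leP x 0%R.
  rewrite (pospow_le0 0 x0) mul0e integral0_eq ?expe2 ?mul0e// => y _.
  by rewrite /riesz_kernel /unit_itv_indic (pospow_le0 0 x0) !mul0e mule0.
have [z1|z1] := leP 1%R z.
  rewrite (pospow_le0 0 (x := 1 - z)) ?subr_le0// mul0e mule0.
  rewrite integral0_eq ?expe2 ?mul0e// => y _.
  rewrite /riesz_kernel /unit_itv_indic (pospow_le0 0 (x := 1 - z)) ?subr_le0//.
  by rewrite !(mule0, mul0e).
rewrite (pospow_gt0E 0 x0) (pospow_gt0E 0 (x := 1 - z)) ?subr_gt0// !powRr0 !mul1e.
congr (_ ^+ 2).
transitivity (\int[mu]_y (p (z - y) * p (y - x) +
    th (1 - y) * (p (y - x) * p (y - z)))).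
  apply: eq_integral => y _; rewrite /riesz_kernel /unit_itv_indic.
  have z0 := lt_trans x0 xz; have x1 := lt_trans xz z1.
  rewrite (pospow_gt0E 0 x0) (pospow_gt0E 0 z0).
  rewrite (pospow_gt0E 0 (x := 1 - x)) ?(pospow_gt0E 0 (x := 1 - z)) ?subr_gt0//.
  rewrite !powRr0 !mul1e ?mule1.
  have [yx|xy] := leP y x.
    by rewrite !(pospow_le0 _ (x := y - x)) ?subr_le0// !(mul0e, mule0) adde0.
  have y0 := lt_trans x0 xy.
  rewrite (pospow_gt0E 0 y0) (pospow_gt0E 0 (x := y - x)) ?subr_gt0// !powRr0 !mul1e.
  rewrite (pospow_le0 _ (x := x - y)) ?subr_le0 ?(ltW xy)// add0e.
  have [y1|y1] := leP 1%R y.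
    rewrite (pospow_le0 _ (x := 1 - y)) ?subr_le0// !mul0e adde0.
    by rewrite (pospow_le0 _ (x := z - y)) ?mul0e// subr_le0 (le_trans _ y1)// ltW.
  rewrite (pospow_gt0E 0 (x := 1 - y)) ?subr_gt0// !powRr0 !mul1e.
  by rewrite ge0_muleDr ?pospow_ge0// addeC [X in X + _]muleC.
rewrite integral_add; [|by measurable_tac|by nonneg_tac|by measurable_tac|by nonneg_tac].
rewrite pospow_convolution; congr (_ * pospow _ _ + _); ring.
Qed.

End four_cycle_evaluation.

(** * The three terms of the expanded square *)

Section four_cycle_value.
Context {R : realType}.
Local Open Scope ereal_scope.
Local Notation th := (@pospow R 0).
Variable d : R.
Hypothesis d_lt : (2 * d < 1)%R.
Local Notation p := (@pospow R (- d)).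
Local Notation q := (@pospow R (1 - 2 * d)).
Local Notation b := (@beta_integral R (- d) (- d)).
Local Notation N := (@tail_integral R d).
Local Notation kappa := (((3 - 4 * d) * (4 - 4 * d))^-1)%R.

(** All three terms end in this integral, with y or w in the place of z for the mixed term and for
    N^2. *)
Lemma integral_kappa :
  \int[mu]_x \int[mu]_z (th x * (th (1 - z) * pospow (2 - 4 * d) (z - x))) = kappa%:E.
Proof.
rewrite integral_pospow_difference; last by move: d_lt; lra.
by congr ((_ * _)^-1%R)%:E; ring.
Qed.

(** Integrating z first, between x and y, is a convolution worth B(1-d, 2-2d) (y-x)^(2-3d); the
    remaining kernel [p (y - x)] lowers the exponent to 2 - 4d. *)
Lemma integral_middle_tail :
  \int[mu]_x \int[mu]_z (th x * (th (1 - z) * (q (z - x) * N x z))) =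
  beta_integral (- d) (1 - 2 * d) * kappa%:E.
Proof.
have mN e (T : measurableType e) := @measurable_tail_integral R d e T.
rewrite -integral_kappa -integral_mull2;
  [|by measurable_tac|by nonneg_tac|exact: beta_integral_ge0].
apply: eq_integral => x _.
transitivity (\int[mu]_z \int[mu]_y ((th x * (th (1 - y) * p (y - x))) *
    (p (y - z) * q (z - x)))).
  apply: eq_integral => z _; rewrite /tail_integral !muleA -integral_mull;
    [|by measurable_tac|by nonneg_tac|by nonneg_tac].
  apply: eq_integral => y _.
  have [yz|zy] := leP y z; first by rewrite (pospow_le0 _ (x := y - z)) ?subr_le0// !(mule0, mul0e).
  have [y1|y1] := leP 1%R y.
    by rewrite (pospow_le0 _ (x := 1 - y)) ?subr_le0// !(mule0, mul0e).
  rewrite (pospow_gt0E _ (x := 1 - z)) ?subr_gt0 ?(lt_trans zy)// powRr0 mule1.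
  by rewrite [LHS](AC (2*(1*2)) (1*(3*4)*(5*2))).
rewrite exchange_integral; [|by measurable_tac|by nonneg_tac].
apply: eq_integral => y _.
rewrite integral_mull; [|by measurable_tac|by nonneg_tac|by nonneg_tac].
rewrite pospow_convolution.
rewrite [LHS](AC (1*(1*1)*2) (4*(1*(2*(3*5)))))/=; congr (_ * (_ * (_ * _))).
by rewrite pospowD; congr pospow; ring.
Qed.

(** N^2 is a double integral over y and w, and symmetry allows y < w at the price of a factor 2.
    Then w is the largest variable, so for fixed x and w the integral over z and y is
    [nested_integral] transported to [x, w]. *)
Lemma integral_tail_sqr :
  \int[mu]_x \int[mu]_z (th x * (th (1 - z) * (th (z - x) * (N x z * N x z)))) =
  2%:E * nested_integral d * kappa%:E.
Proof.
rewrite -muleA -integral_kappa -integral_mull2;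
  [|by measurable_tac|by nonneg_tac|exact: nested_integral_ge0].
rewrite -integral_mull; last first.
- by [].
- by move=> x; apply: integral_ge0 => y _; rewrite mule_ge0 ?nested_integral_ge0//; nonneg_tac.
- by apply: measurable_integral; [move=> *; rewrite mule_ge0 ?nested_integral_ge0//; nonneg_tac|measurable_tac].
apply: eq_integral => x _.
pose n z y := th (1 - y) * (p (y - x) * p (y - z)).
have n0 z y : 0 <= n z y by rewrite /n; nonneg_tac.
pose G z y w := th x * (th (1 - w) * p (w - x)) * (th (z - x) * p (w - z) *
    (th (w - y) * (p (y - x) * p (y - z)))).
have G0 z y w : 0 <= G z y w by rewrite /G; nonneg_tac.
have mG e (T : measurableType e) (z y w : T -> R) :
    measurable_fun setT z -> measurable_fun setT y -> measurable_fun setT w ->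
    measurable_fun setT (fun t => G (z t) (y t) (w t)).
  by move=> *; rewrite /G; measurable_tac.
transitivity (2%:E * \int[mu]_z \int[mu]_y \int[mu]_w G z y w).
  rewrite -integral_mull; last first.
  - by [].
  - by move=> z; apply: integral_ge0 => y _; exact: integral_ge0.
  - apply: measurable_integral; first by move=> z y; exact: integral_ge0.
    by apply: measurable_integral => //; apply: mG; measurable_tac.
  apply: eq_integral => z _.
  have NE : N x z * N x z = 2%:E * \int[mu]_y \int[mu]_w (th (w - y) * (n z y * n z w)).
    rewrite -(integral_symmetric (F := fun y w => n z y * n z w)); last 3 first.
    - by rewrite /n; measurable_tac.
    - by move=> y w; rewrite mule_ge0.
    - by move=> y w; rewrite muleC.
    have mn : measurable_fun setT (n z) by rewrite /n; measurable_tac.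
    rewrite -[N x z]/(\int[mu]_y n z y) -integral_mulr;
      [|exact: mn|exact: n0|by apply: integral_ge0 => y _; exact: n0].
    by apply: eq_integral => y _; rewrite integral_mull; [|exact: mn|exact: n0|exact: n0].
  rewrite NE [LHS](AC (1*(1*(1*2))) (4*((1*2*3)*5)))/=.
  apply: (congr1 (fun u => 2%:E * u)).
  rewrite -integral_mull2;
    [|by rewrite /n; measurable_tac|by rewrite /n; nonneg_tac|by nonneg_tac].
  apply: eq_integral => y _; apply: eq_integral => w _; rewrite /n /G.
  have [w1|w1] := leP 1%R w.
    by rewrite (pospow_le0 _ (x := 1 - w)) ?subr_le0// !(mule0, mul0e).
  have [wy|yw] := leP w y.
    by rewrite (pospow_le0 _ (x := w - y)) ?subr_le0// !(mule0, mul0e).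
  have [wz|zw] := leP w z.
    by rewrite (pospow_le0 _ (x := w - z)) ?subr_le0// !(mule0, mul0e).
  (* The bounds z < 1 and y < 1 follow from z, y < w < 1, so w alone keeps its indicator. *)
  rewrite (pospow_gt0E _ (x := 1 - z)) ?subr_gt0 ?(lt_trans zw)// powRr0 mule1.
  rewrite (pospow_gt0E _ (x := 1 - y)) ?subr_gt0 ?(lt_trans yw)// powRr0 mul1e.
  by rewrite [LHS](AC (2*(1*(2*(1*2)))) (1*(6*7)*(2*8*(3*(4*5))))).
apply: (congr1 (fun u => 2%:E * u)).
transitivity (\int[mu]_w \int[mu]_z \int[mu]_y G z y w).
  transitivity (\int[mu]_z \int[mu]_w \int[mu]_y G z y w).
    apply: eq_integral => z _; apply: exchange_integral; last by move=> *; exact: G0.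
    by apply: mG; measurable_tac.
  apply: exchange_integral; last by move=> *; exact: integral_ge0.
  apply: measurable_integral; first by move=> *; exact: G0.
  by apply: mG; measurable_tac.
apply: eq_integral => w _; rewrite /G.
rewrite integral_mull2; [|by measurable_tac|by nonneg_tac|by nonneg_tac].
rewrite nested_integral_scale.
rewrite [LHS](AC (1*2*2) (4*(1*(2*(3*5)))))/=; congr (_ * (_ * (_ * _))).
by rewrite pospowD; congr pospow; ring.
Qed.

Lemma ge0_mule_expand (x y z k : \bar R) : 0 <= x -> 0 <= y -> 0 <= z ->
  x * x * k + 2%:E * x * (y * k) + 2%:E * z * k =
  (x * x + 2%:E * (x * y) + 2%:E * z) * k.
Proof.
move=> x0 y0 z0; have t0 : 0 <= 2%:E :> \bar R by [].
by rewrite !ge0_muleDl ?adde_ge0 ?mule_ge0// !muleA.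
Qed.

Lemma ge0_mule_sqrD (c u v : \bar R) : 0 <= c -> 0 <= u -> 0 <= v ->
  c * (u + v) ^+ 2 = c * (u * u) + 2%:E * (c * (u * v)) + c * (v * v).
Proof.
move=> c0 u0 v0; rewrite expe2 ge0_muleDl// !ge0_muleDr//.
- by rewrite (muleC v u) mule_natl mule2n !addeA.
all: by rewrite ?adde_ge0 ?mule_ge0.
Qed.

Lemma four_cycle_value :
  \int[mu]_x \int[mu]_z
    (th x * (th (1 - z) * (th (z - x) * (b * q (z - x) + N x z) ^+ 2))) =
  (b * b + 2%:E * (b * beta_integral (- d) (1 - 2 * d)) + 2%:E * nested_integral d)
    * kappa%:E.
Proof.
have b0 : 0 <= b by exact: beta_integral_ge0.
have N0 := tail_integral_ge0 d.
have mN e (T : measurableType e) := @measurable_tail_integral R d e T.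
pose A x z := b * b * (th x * (th (1 - z) * pospow (2 - 4 * d) (z - x))).
pose B x z := 2%:E * b * (th x * (th (1 - z) * (q (z - x) * N x z))).
pose C x z := th x * (th (1 - z) * (th (z - x) * (N x z * N x z))).
have A0 x z : 0 <= A x z by rewrite /A !mule_ge0 ?pospow_ge0.
have B0 x z : 0 <= B x z by rewrite /B !mule_ge0 ?pospow_ge0.
have C0 x z : 0 <= C x z by rewrite /C !mule_ge0 ?pospow_ge0.
have mA : measurable_fun setT (fun t : R * R => A t.1 t.2).
  by rewrite /A; measurable_tac.
have mB : measurable_fun setT (fun t : R * R => B t.1 t.2).
  by rewrite /B; measurable_tac; apply: mN; measurable_tac.
have mC : measurable_fun setT (fun t : R * R => C t.1 t.2).
  by rewrite /C; measurable_tac; apply: mN; measurable_tac.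
transitivity (\int[mu]_x \int[mu]_z ((A x z + B x z) + C x z)).
  apply: eq_integral => x _; apply: eq_integral => z _.
  have qq : q (z - x) * q (z - x) = pospow (2 - 4 * d) (z - x).
    by rewrite pospowD; congr pospow; ring.
  have thp s : th (z - x) * pospow s (z - x) = pospow s (z - x).
    by rewrite pospowD add0r.
  have E u : th x * (th (1 - z) * (th (z - x) * u)) = th x * th (1 - z) * th (z - x) * u.
    by rewrite !muleA.
  rewrite E ge0_mule_sqrD -?E; last 3 first.
  - by rewrite !mule_ge0 ?pospow_ge0.
  - by rewrite mule_ge0 ?pospow_ge0.
  - exact: N0.
  congr (_ + _ + _).
  - by rewrite muleACA qq (muleCA (th (z - x)) (b * b)) thp /A !(muleCA (b * b)).
  - rewrite /B -[RHS]muleA; apply: (congr1 (fun u => 2%:E * u)).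
    rewrite -(muleA b) (muleCA (th (z - x)) b) (muleA (th (z - x))) thp.
    by rewrite (muleCA (th (1 - z)) b) (muleCA (th x) b).
have IA : \int[mu]_x \int[mu]_z A x z = b * b * kappa%:E.
  rewrite /A integral_mull2; [|by measurable_tac|by nonneg_tac|by rewrite mule_ge0].
  by rewrite integral_kappa.
have IB : \int[mu]_x \int[mu]_z B x z =
    2%:E * b * (beta_integral (- d) (1 - 2 * d) * kappa%:E).
  rewrite /B integral_mull2; last 3 first.
  - by measurable_tac; apply: mN; measurable_tac.
  - by move=> x z; rewrite !mule_ge0 ?pospow_ge0.
  - by rewrite mule_ge0.
  by rewrite integral_middle_tail.
have b10 : 0 <= beta_integral (- d) (1 - 2 * d) by exact: beta_integral_ge0.
have J0 : 0 <= nested_integral d by exact: nested_integral_ge0.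
rewrite integral_add2; [|exact: emeasurable_funD
  |by move=> x z; rewrite adde_ge0|exact: mC|exact: C0].
rewrite integral_add2; [|exact: mA|exact: A0|exact: mB|exact: B0].
rewrite IA IB [X in _ + _ + X]integral_tail_sqr.
exact: (@ge0_mule_expand b (beta_integral (- d) (1 - 2 * d)) _ kappa%:E b0 b10 J0).
Qed.

End four_cycle_value.

(** * The binomial series from the Gamma integral *)

Section binomial_series.
Context {R : realType}.
Local Open Scope ereal_scope.
Local Notation th := (@pospow R 0).

Lemma EFin_series_lim (u : nat -> R) : cvgn (series u) ->
  \sum_(n <oo) (u n)%:E = (limn (series u))%:E.
Proof.
move=> cu; rewrite -EFin_lim//; apply/congr_lim/funext => n.
by rewrite /series/= sumEFin.
Qed.

Lemma expR_eseries (x : R) : \sum_(n <oo) (x ^+ n / n`!%:R)%:E = (expR x)%:E.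
Proof. by rewrite EFin_series_lim//; exact: is_cvg_series_exp_coeff. Qed.

Lemma pochhammer_ge0 (a : R) n : (0 <= a)%R -> (0 <= pochhammer a n)%R.
Proof. by move=> a0; apply: prodr_ge0 => i _; rewrite addr_ge0. Qed.

Lemma pochhammer_gt0 (a : R) n : (0 < a)%R -> (0 < pochhammer a n)%R.
Proof. by move=> a0; apply: prodr_gt0 => i _; rewrite ltr_wpDr. Qed.

Lemma pochhammerS (a : R) n : pochhammer a n.+1 = (pochhammer a n * (a + n%:R))%R.
Proof. by rewrite /pochhammer big_ord_recr. Qed.

(** The Laplace transform of t^(a-1), used at c = 1 - z. *)
Lemma gamma_integral_scale (a c : R) : (0 < c)%R ->
  \int[mu]_t (pospow (a - 1) t * (expR (- (c * t)))%:E) =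
  (c `^ (- a))%:E * gamma_integral a.
Proof.
move=> c0.
pose f (t : R) := pospow (a - 1) t * (expR (- t))%:E.
have f0 t : 0 <= f t by rewrite /f; nonneg_tac.
have mf : measurable_fun setT f.
  by apply: emeasurable_funM; [measurable_tac|exact: measurable_expRN].
rewrite -[gamma_integral a]/(\int[mu]_t f t) -(integral_scale c0 mf f0).
have mfc : measurable_fun setT (fun t => f (c * t)%R).
  by apply: (measurableT_comp mf); measurable_tac.
rewrite muleA -EFinM -[RHS]integral_mull; last 3 first.
- exact: mfc.
- by move=> t; exact: f0.
- by rewrite lee_fin mulr_ge0 ?powR_ge0 ?ltW.
have k : (c `^ (- a) * c * c `^ (a - 1) = 1)%R.
  rewrite -[X in (_ * X * _)%R](powRr1 (ltW c0)) -!powRD ?(gt_eqF c0) ?implybT//.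
  by rewrite (_ : - a + 1 + (a - 1) = 0)%R ?powRr0//; ring.
by apply: eq_integral => t _; rewrite /f pospowM// !muleA -EFinM k mul1e.
Qed.

(* (1 - z)^(-a) Gamma a is the integral of t^(a-1) e^(-t) e^(zt), and the series
   of e^(zt) can be integrated termwise because its terms are nonnegative. *)
Lemma binomial_eseries (a z : R) : (0 < a)%R -> (0 <= z)%R -> (z < 1)%R ->
  \sum_(n <oo) (pochhammer a n / n`!%:R * z ^+ n)%:E = ((1 - z) `^ (- a))%:E.
Proof.
move=> a0 z0 z1; have G0 := Gamma_gt0 a0.
have u0 n : (0 <= pochhammer a n / n`!%:R * z ^+ n)%R.
  by rewrite mulr_ge0 ?exprn_ge0// divr_ge0 ?pochhammer_ge0// ltW.
suff : (Gamma a)%:E * \sum_(n <oo) (pochhammer a n / n`!%:R * z ^+ n)%:E =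
    (Gamma a)%:E * ((1 - z) `^ (- a))%:E.
  move=> /(congr1 (fun x => ((Gamma a)^-1)%:E * x)).
  by rewrite !muleA -!EFinM mulVf ?gt_eqF// !mul1e mul1r.
rewrite -gamma_integralE// [RHS]muleC -gamma_integral_scale ?subr_gt0//.
(* Merging t^n into the power makes the n-th integral Gamma(a + n) z^n / n!, and Gamma(a + n) =
   (a)_n Gamma(a). *)
pose g n (t : R) := (z ^+ n / n`!%:R)%:E *
  (pospow (a + n%:R - 1) t * (expR (- t))%:E).
have mg n : measurable_fun setT (g n).
  apply: emeasurable_funM => //.
  by apply: emeasurable_funM; [measurable_tac|exact: measurable_expRN].
have zn0 n : (0 <= z ^+ n / n`!%:R)%R by rewrite divr_ge0 ?exprn_ge0.
have g0 n t : 0 <= g n t.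
  by rewrite /g mule_ge0// ?lee_fin//; nonneg_tac.
transitivity (\int[mu]_t \sum_(n <oo) g n t); last first.
  apply: eq_integral => t _; rewrite /g.
  have [t0|t0] := leP t 0%R.
    rewrite (pospow_le0 _ t0) mul0e eseries0// => n _ _.
    by rewrite (pospow_le0 _ t0) mul0e mule0.
  transitivity (\sum_(n <oo) ((t `^ (a - 1) * expR (- t))%:E *
      ((z * t) ^+ n / n`!%:R)%:E)).
    apply: eq_eseriesr => n _; rewrite pospow_gt0E// -!EFinM; congr EFin.
    rewrite (_ : a + n%:R - 1 = a - 1 + n%:R)%R; last by ring.
    rewrite powRD ?(gt_eqF t0) ?implybT// powR_mulrn ?ltW// exprMn.
    by ring.
  rewrite nneseriesZl; last first.
    by move=> n _; rewrite lee_fin divr_ge0 ?exprn_ge0// mulr_ge0// ltW.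
  rewrite expR_eseries pospow_gt0E// -!EFinM -mulrA -expRD.
  by congr (_ * expR _)%:E; ring.
rewrite integral_nneseries//.
rewrite gamma_integralE// -nneseriesZl; last by move=> n _; rewrite lee_fin.
apply: eq_eseriesr => n _; rewrite /g integral_mull; last 3 first.
- by apply: emeasurable_funM; [measurable_tac|exact: measurable_expRN].
- by nonneg_tac.
- by rewrite lee_fin.
rewrite -/(gamma_integral (a + n%:R)) !gamma_integralE ?ltr_wpDr//.
by rewrite Gamma_pochhammer// -!EFinM; congr EFin; ring.
Qed.

End binomial_series.

(** * The nested integral as a 3F2 value *)

Section nested_integral_series.
Context {R : realType}.
Local Open Scope ereal_scope.
Local Notation th := (@pospow R 0).
Variable d : R.
Hypotheses (d0 : (0 < d)%R) (d_lt : (2 * d < 1)%R).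
Local Notation p := (@pospow R (- d)).

Lemma beta_integral_nat n : beta_integral (- d) n%:R =
  (n`!%:R / ((1 - d) * pochhammer (2 - d) n))%:E.
Proof.
have := @beta_integralE R (1 - d) (n.+1%:R) _ _.
rewrite -natr1 addrK (_ : 1 - d - 1 = - d)%R; last by ring.
move=> ->; [|by move: d_lt; lra|by rewrite natr1].
rewrite natr1 Gamma_nat -natr1 (_ : 1 - d + (n%:R + 1) = 2 - d + n%:R)%R; last by ring.
have d2 : (0 < 2 - d)%R by move: d_lt d0; lra.
have d1 : (0 < 1 - d)%R by move: d_lt d0; lra.
rewrite Gamma_pochhammer// (_ : 2 - d = 1 - d + 1)%R; last by ring.
rewrite GammaS//; have G0 := Gamma_gt0 d1.
have P0 : (0 < pochhammer (1 - d + 1) n)%R by rewrite pochhammer_gt0// addr_gt0.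
congr EFin; field.
by rewrite !gt_eqF.
Qed.

(** In the n-th term the z-integral is the convolution B(1-d, n+1) y^(n+1-d), and integrating it
    against y^(-d) gives 1/(n+2-2d); the n! of the binomial coefficient cancels that of the beta
    value. *)
Lemma nested_integral_eseries : nested_integral d =
  \sum_(n <oo) (pochhammer d n /
    ((1 - d) * pochhammer (2 - d) n * (2 - 2 * d + n%:R)))%:E.
Proof.
pose a n : R := (pochhammer d n / n`!%:R)%R.
have a0 n : (0 <= a n)%R by rewrite divr_ge0// pochhammer_ge0// ltW.
pose F n (y z : R) := th (1 - y) * p y * ((a n)%:E * (p (y - z) * pospow n%:R (z - 0))).
have F0 n y z : 0 <= F n y z.
  by rewrite /F; nonneg_tac.
have mF n e (T : measurableType e) (y z : T -> R) : measurable_fun setT y ->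
    measurable_fun setT z -> measurable_fun setT (fun t => F n (y t) (z t)).
  by move=> my mz; rewrite /F; measurable_tac.
transitivity (\int[mu]_y \int[mu]_z \sum_(n <oo) F n y z).
  rewrite /nested_integral exchange_integral; [|by measurable_tac|by nonneg_tac].
  apply: eq_integral => y _; apply: eq_integral => z _.
  have zero (G : nat -> \bar R) : (forall n, G n = 0) -> \sum_(n <oo) G n = 0.
    by move=> G0; rewrite eseries0.
  have [z0|z0] := leP z 0%R.
    rewrite (pospow_le0 0 z0) !mul0e zero// => n.
    by rewrite /F subr0 (pospow_le0 _ z0) !mule0.
  have [yz|zy] := leP y z.
    rewrite (pospow_le0 _ (x := y - z)) ?subr_le0// !mule0 zero// => n.
    by rewrite /F (pospow_le0 _ (x := y - z)) ?subr_le0// mul0e !mule0.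
  have [y1|y1] := leP 1%R y.
    rewrite (pospow_le0 _ (x := 1 - y)) ?subr_le0// mul0e mule0 zero// => n.
    by rewrite /F (pospow_le0 _ (x := 1 - y)) ?subr_le0// !mul0e.
  have z1 := lt_trans zy y1; have y0 := lt_trans z0 zy.
  have -> : th z * p (1 - z) * (th (1 - y) * (p y * p (y - z))) =
     (y `^ (- d) * (y - z) `^ (- d))%:E * \sum_(n <oo) (a n * z ^+ n)%:E.
    rewrite binomial_eseries ?(ltW z0)//.
    rewrite !pospow_gt0E ?subr_gt0// !powRr0 !mul1e -!EFinM; congr EFin; ring.
  rewrite -nneseriesZl; last by move=> n _; rewrite lee_fin mulr_ge0// exprn_ge0// ltW.
  apply: eq_eseriesr => n _; rewrite /F !pospow_gt0E ?subr_gt0//.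
  by rewrite powRr0 mul1e -!EFinM subr0 powR_mulrn ?(ltW z0)//; congr EFin; ring.
transitivity (\sum_(n <oo) \int[mu]_y \int[mu]_z F n y z).
  rewrite -integral_nneseries//; last 2 first.
  - by move=> n; apply: measurable_integral => //; apply: mF; measurable_tac.
  - by move=> n y _; exact: integral_ge0.
  apply: eq_integral => y _; rewrite integral_nneseries// => n.
  by apply: mF; measurable_tac.
apply: eq_eseriesr => n _; rewrite /F.
transitivity (\int[mu]_y ((a n)%:E * beta_integral (- d) n%:R *
    (th (1 - y) * pospow (n%:R + 1 - 2 * d) y))).
  apply: eq_integral => y _.
  rewrite integral_mull; last 3 first.
  - by measurable_tac.
  - by nonneg_tac.
  - by nonneg_tac.
  rewrite integral_mull; last 3 first.
  - by measurable_tac.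
  - by nonneg_tac.
  - by rewrite lee_fin.
  rewrite pospow_convolution subr0.
  rewrite [LHS](AC (2*(1*2)) (3*4*(1*(2*5))))/= pospowD.
  by congr (_ * (_ * pospow _ _)); ring.
rewrite integral_mull; last 3 first.
- by measurable_tac.
- by nonneg_tac.
- by rewrite mule_ge0 ?lee_fin// beta_integral_ge0.
rewrite -/(beta_integral 0 (n%:R + 1 - 2 * d)) beta_integral0l; last first.
  by have := ler0n R n; move: d_lt; lra.
rewrite beta_integral_nat -!EFinM /a; congr EFin.
have P0 : (0 < pochhammer (2 - d) n)%R by rewrite pochhammer_gt0//; move: d_lt d0; lra.
have n0 : (n`!%:R != 0 :> R)%R by rewrite pnatr_eq0 -lt0n fact_gt0.
have d1 : (0 < 1 - d)%R by move: d_lt d0; lra.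
have N0 := ler0n R n.
have c0 : (0 < 2 - 2 * d + n%:R)%R by move: d_lt; lra.
have -> : (n%:R + 1 - 2 * d + 1 = 2 - 2 * d + n%:R)%R by ring.
by field; rewrite n0 !gt_eqF.
Qed.

Lemma pochhammer1 n : pochhammer (1 : R) n = n`!%:R%R.
Proof.
elim: n => [|n IH]; first by rewrite /pochhammer big_ord0.
by rewrite pochhammerS IH factS natrM mulrC -natr1 addrC.
Qed.

Lemma pochhammer_shift (x : R) n :
  (x * pochhammer (x + 1) n = pochhammer x n * (x + n%:R))%R.
Proof.
rewrite -pochhammerS /pochhammer big_ord_recl/= addr0; congr (_ * _)%R.
by apply: eq_bigr => i _; rewrite /bump/= -natr1 addrA addrAC.
Qed.

(** (1)_n cancels n!, and (2-2d)_n / (3-2d)_n telescopes because the parameters differ by 1. *)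
Lemma hypergeometric_term n :
  (pochhammer 1 n * pochhammer d n * pochhammer (2 - 2 * d) n
    / (pochhammer (2 - d) n * pochhammer (3 - 2 * d) n) * (1 ^+ n / n`!%:R) =
  pochhammer d n / pochhammer (2 - d) n * ((2 - 2 * d) / (2 - 2 * d + n%:R)) :> R)%R.
Proof.
have N0 := ler0n R n.
have c0 : (0 < 2 - 2 * d + n%:R)%R by move: d_lt; lra.
have x0 : (0 < 2 - 2 * d)%R by move: d_lt; lra.
have n0 : (n`!%:R != 0 :> R)%R by rewrite pnatr_eq0 -lt0n fact_gt0.
have P2 : (0 < pochhammer (2 - d) n)%R by rewrite pochhammer_gt0//; move: d_lt d0; lra.
have P3 : (0 < pochhammer (3 - 2 * d) n)%R by rewrite pochhammer_gt0//; move: d_lt; lra.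
have S : (pochhammer (2 - 2 * d) n =
    (2 - 2 * d) * pochhammer (3 - 2 * d) n / (2 - 2 * d + n%:R))%R.
  rewrite (_ : 3 - 2 * d = 2 - 2 * d + 1)%R; last by ring.
  by rewrite pochhammer_shift mulfK// gt_eqF.
rewrite expr1n pochhammer1 S; field.
by rewrite n0 !gt_eqF.
Qed.

(** The inductive step is (d+n)/(2-d+n) <= (n+1)/(n+2), that is 2dn + 3d <= n + 2. *)
Lemma pochhammer_ratio_le n :
  (pochhammer d n / pochhammer (2 - d) n <= n.+1%:R^-1)%R.
Proof.
elim: n => [|n IH]; first by rewrite /pochhammer !big_ord0 divr1 invr1.
have N0 := ler0n R n.
have dn : (0 < 2 - d + n%:R)%R by move: d_lt d0; lra.
rewrite !pochhammerS invfM mulrACA.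
apply: (@le_trans _ _ (n.+1%:R^-1 * ((d + n%:R) / (2 - d + n%:R)))%R).
  by rewrite ler_wpM2r// divr_ge0 ?(ltW dn)// addr_ge0 ?(ltW d0).
rewrite mulrA ler_pdivrMr// [leLHS]mulrC ler_pdivrMr// -mulrA [leRHS]mulrC.
rewrite ler_pdivlMr// -!natr1.
by move: d_lt d0; nra.
Qed.

Let u n : R := (pochhammer d n / pochhammer (2 - d) n *
  ((2 - 2 * d) / (2 - 2 * d + n%:R)))%R.

Let u_ge0 n : (0 <= u n)%R.
Proof.
have N0 := ler0n R n.
have c0 : (0 < 2 - 2 * d + n%:R)%R by move: d_lt; lra.
have x0 : (0 < 2 - 2 * d)%R by move: d_lt; lra.
rewrite /u mulr_ge0// divr_ge0 ?pochhammer_ge0//; move: d_lt d0; lra.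
Qed.

(** Convergence at z = 1 is what identifies the real [limn] with the extended series. The terms are
    at most 2/((n+1)(n+2)), which telescopes. *)
Lemma hypergeometric_cvg : cvgn (series u).
Proof.
apply: nondecreasing_is_cvgn.
  apply/nondecreasing_seqP => n; rewrite /series/= big_nat_recr//=.
  by rewrite lerDl.
exists 2%R => _ [n _ <-].
suff : (series u n <= 2 - 2 / n.+1%:R)%R.
  by move=> /le_trans; apply; rewrite lerBlDr lerDl divr_ge0.
elim: n => [|n IH]; first by rewrite /series/= big_geq// divr1 subrr.
rewrite /series/= big_nat_recr//=; move: IH; rewrite /series/= => IH.
have N0 := ler0n R n.
have c0 : (0 < 2 - 2 * d + n%:R)%R by move: d_lt; lra.
suff un : (u n <= 2 / n.+1%:R - 2 / n.+2%:R)%R.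
  by rewrite (le_trans (lerD IH un))// addrA subrK.
(* The map x -> x/(x+n) is nondecreasing for x > 0, and 2 - 2d <= 2. *)
have e : ((2 - 2 * d) / (2 - 2 * d + n%:R) <= 2 / n.+2%:R)%R.
  rewrite ler_pdivrMr// mulrAC ler_pdivlMr// -!natr1.
  by move: d0; nra.
apply: (@le_trans _ _ (n.+1%:R^-1 * (2 / n.+2%:R))%R).
  apply: ler_pM => //; last exact: pochhammer_ratio_le.
  - by rewrite divr_ge0 ?pochhammer_ge0//; move: d_lt d0; lra.
  - by rewrite divr_ge0// ?(ltW c0)//; move: d_lt; lra.
rewrite le_eqVlt; apply/orP; left; apply/eqP.
rewrite -!natr1; field.
by rewrite !gt_eqF// ltr_wpDl// ltr_wpDl.
Qed.

(** The constant comes from 2/(1-d) = (1-d)^(-2) (2-2d), the factor 2 - 2d belonging to the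
    hypergeometric term. *)
Lemma nested_integral_hypergeometric :
  2%:E * nested_integral d =
  ((1 - d) ^- 2 * hypergeometric_3F2 1 d (2 - 2 * d) (2 - d) (3 - 2 * d) 1)%R%:E.
Proof.
rewrite /hypergeometric_3F2 (_ : (fun n : nat => _) = u); last first.
  by apply/funext => n; rewrite hypergeometric_term.
rewrite EFinM -(EFin_series_lim hypergeometric_cvg) -nneseriesZl; last first.
  by move=> n _; rewrite lee_fin.
rewrite nested_integral_eseries -nneseriesZl; last first.
  move=> n _; rewrite lee_fin divr_ge0 ?pochhammer_ge0 ?ltW//.
  have N0 := ler0n R n.
  rewrite !mulr_gt0 ?pochhammer_gt0//; move: d_lt d0; lra.
apply: eq_eseriesr => n _; rewrite -EFinM /u; congr EFin.
have N0 := ler0n R n.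
have P0 : (0 < pochhammer (2 - d) n)%R by rewrite pochhammer_gt0//; move: d_lt d0; lra.
have d1 : (0 < 1 - d)%R by move: d_lt d0; lra.
have c0 : (0 < 2 - 2 * d + n%:R)%R by move: d_lt; lra.
by field; rewrite !gt_eqF.
Qed.

End nested_integral_series.

(** * Assembly and the endpoint d = 0 *)

Section fourth_cumulant.
Context {R : realType}.

(** 48 sigma^4 with sigma^4 = (sigma^2)^2; the bounds on d make the radicand nonnegative. *)
Lemma rosenblatt_cumulant4E (d : R) : (0 <= d)%R -> (2 * d <= 1)%R ->
  rosenblatt_cumulant d 4 =
  ((12 * (1 - 2 * d) ^+ 2 * (1 - d) ^+ 2)%:E * rosenblatt_c d 4)%E.
Proof.
move=> d0 d1; rewrite /rosenblatt_cumulant; congr (_%:E * _)%E.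
rewrite /rosenblatt_sigma (exprM _ 2 2) sqr_sqrtr; last first.
  by rewrite !mulr_ge0//; move: d0 d1; lra.
by rewrite /= !factS fact0 !natrM; field.
Qed.

(** The 4 of the symmetry reduction turns (3-4d)(4-4d) into (3-4d)(1-d), and Gamma(2-2d) cancels in
    the mixed term. *)
Lemma rosenblatt_c4_value (d : R) : (0 < d)%R -> (2 * d < 1)%R ->
  rosenblatt_c d 4 =
  (((Gamma (1 - d) ^+ 2 / Gamma (2 - 2 * d)) ^+ 2
    + 2 * Gamma (1 - d) ^+ 3 / Gamma (3 - 3 * d)
    + (1 - d) ^- 2 * hypergeometric_3F2 1 d (2 - 2 * d) (2 - d) (3 - 2 * d) 1)
   / ((3 - 4 * d) * (1 - d)))%:E.
Proof.
move=> d0 d_lt.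
rewrite rosenblatt_c4E// integral_four_cycle; last 3 first.
- by apply: measurable_riesz_kernel; measurable_tac.
- exact: riesz_kernel_ge0.
- exact: riesz_kernelC.
under eq_integral => x _ do under eq_integral => z _ do rewrite riesz_kernel_composition.
rewrite four_cycle_value// nested_integral_hypergeometric//.
have d1 : 0 < 1 - d by move: d_lt d0; lra.
have d2 : 0 < 2 - 2 * d by move: d_lt d0; lra.
have bE : beta_integral (- d) (- d) = (Gamma (1 - d) * Gamma (1 - d) / Gamma (2 - 2 * d))%:E.
  have := beta_integralE d1 d1.
  have -> : 1 - d - 1 = - d by ring.
  by have -> : 1 - d + (1 - d) = 2 - 2 * d by ring.
have b1E : beta_integral (- d) (1 - 2 * d) =
    (Gamma (1 - d) * Gamma (2 - 2 * d) / Gamma (3 - 3 * d))%:E.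
  have := beta_integralE d1 d2.
  have -> : 1 - d - 1 = - d by ring.
  have -> : 2 - 2 * d - 1 = 1 - 2 * d by ring.
  by have -> : 1 - d + (2 - 2 * d) = 3 - 3 * d by ring.
rewrite bE b1E.
rewrite -!EFinM; congr EFin.
have d3 : 0 < 3 - 4 * d by move: d_lt d0; lra.
have d4 : 0 < 4 - 4 * d by move: d_lt d0; lra.
have : 0 < Gamma (2 - 2 * d) by apply: Gamma_gt0.
have : 0 < Gamma (3 - 3 * d) by apply: Gamma_gt0; move: d_lt d0; lra.
move: (Gamma (1 - d)) (Gamma (2 - 2 * d)) (Gamma (3 - 3 * d)) (hypergeometric_3F2 _ _ _ _ _ _).
move=> g1 g2 g3 H g30 g20; clear bE b1E.
by field; rewrite !gt_eqF.
Qed.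

Lemma rosenblatt_c0 (k : nat) : rosenblatt_c (0 : R) k = 1%E.
Proof.
have K (s : seq R) : cyclic_kernel 0 k s = 1.
  by rewrite /cyclic_kernel big1// => i _; rewrite oppr0 powRr0.
rewrite /rosenblatt_c.
rewrite (_ : (fun s => _) = cst (1%:E)); last by apply/funext => s; rewrite K.
elim: k {K} => [//|k IH] /=.
have -> : (fun x : R => cube_integral k (fun s => cst 1%:E (x :: s))) = cst 1%E.
  by apply/funext => x.
rewrite integral_cst//=.
by rewrite lebesgue_measure_itv/= lte_fin ltr01 oppr0 adde0 mul1e.
Qed.

Lemma hypergeometric_3F2_0 (a c e f z : R) : hypergeometric_3F2 a 0 c e f z = 1.
Proof.
rewrite /hypergeometric_3F2; set u := fun n : nat => _.
have u0 : u 0 = 1 by rewrite /u /pochhammer !big_ord0 expr0 fact0 !(mulr1, divr1).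
have uS n : u n.+1 = 0.
  by rewrite /u {2}/pochhammer big_ord_recl/= addr0 mul0r mulr0 !mul0r.
(* The empty partial sum is 0, so the partial sums equal 1 only from index 1 on. *)
apply/cvg_lim => //; rewrite -cvg_shiftS/=.
rewrite (_ : (fun n => _) = cst 1); first exact: cvg_cst.
apply/funext => n; rewrite /series/= big_nat_recl//= u0 big1 ?addr0//.
Qed.

End fourth_cumulant.

Theorem mainTheorem1 (R : realType) (d : R) (hd0 : 0 <= d) (hd1 : d <= 1 / 2) :
  rosenblatt_cumulant d 4 =
  (12 * (1 - 2 * d) ^+ 2 / ((1 - d) * (3 - 4 * d)) *
   (2 * Gamma (1 - d) * Gamma (2 - d) ^+ 2 / Gamma (3 - 3 * d)
    + Gamma (1 - d) ^+ 2 * Gamma (2 - d) ^+ 2 / Gamma (2 - 2 * d) ^+ 2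
    + hypergeometric_3F2 1 d (2 - 2 * d) (2 - d) (3 - 2 * d) 1))%:E.
Proof.
have d_le : 2 * d <= 1 by lra.
rewrite rosenblatt_cumulant4E//.
(* At d = 1/2 both sides carry the factor 1 - 2d = 0, which annihilates c_4 whatever its extended
   value. *)
have [d_lt|d_ge] := ltP (2 * d) 1; last first.
  have -> : 1 - 2 * d = 0 by lra.
  by rewrite expr0n/= !(mulr0, mul0r) mul0e.
(* At d = 0 the kernel is identically 1, so c_4 = 1, and both sides are 12 = (12/3)(1 + 1 + 1). *)
have [d0|d_gt] := leP d 0.
  have -> : d = 0 by lra.
  rewrite rosenblatt_c0 hypergeometric_3F2_0 !(mulr0, subr0).
  have -> : Gamma (2 : R) = 1 by rewrite (@Gamma_nat R 1).
  have -> : Gamma (3 : R) = 2 by rewrite (@Gamma_nat R 2).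
  by rewrite Gamma1 mule1; congr EFin; field.
rewrite rosenblatt_c4_value// -EFinM; congr EFin.
have d1 : 0 < 1 - d by lra.
have d3 : 0 < 3 - 4 * d by lra.
(* This absorbs the factor (1-d)^2 of the cumulant into the two Gamma terms; in the third it cancels
   (1-d)^(-2). *)
have -> : Gamma (2 - d) = (1 - d) * Gamma (1 - d).
  by rewrite -GammaS// (_ : 1 - d + 1 = 2 - d)//; ring.
have : 0 < Gamma (2 - 2 * d) by apply: Gamma_gt0; lra.
have : 0 < Gamma (3 - 3 * d) by apply: Gamma_gt0; lra.
move: (Gamma (1 - d)) (Gamma (2 - 2 * d)) (Gamma (3 - 3 * d)) (hypergeometric_3F2 _ _ _ _ _ _).
move=> g1 g2 g3 H g30 g20.
by field; rewrite !gt_eqF.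
Qed.
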